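(* Let $k\in l_2(X)$ with $\check k\in H^\infty(G)$. Then (i) $W_k$ is invertible on $l_2(X_+)$ if and only if $\check k$ is invertible in the algebra $H^\infty(G)$; (ii) $\sigma(W_k)=\sigma_{H^\infty}(\check k)$, the spectrum of $\check k$ in the Banach algebra $H^\infty(G)$.
   Context: $X$ is a discrete linearly ordered abelian group with positive cone $X_+$; $G$ is its compact dual group with normalized Haar measure. $\check k(x)=\sum_{\xi\in X}k(\xi)\xi(x)$; $W_kg=1_{X_+}(k\ast g)$ on $l_2(X_+)$. $H^\infty(G)=\{f\in L^\infty(G):\widehat f(\chi)=0\ \forall\chi\notin X_+\}$ with the $L^\infty$ norm, where $\widehat f(\xi)=\int_Gf(x)\overline{\xi(x)}dx$. *)

(* Defs.v *)
From HB Require Import structures.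
From mathcomp Require Import all_boot all_order all_algebra.
From mathcomp Require Import finmap.
From mathcomp Require Import all_classical all_reals all_analysis.
From mathcomp.real_closed Require Import complex.
Set Implicit Arguments. Unset Strict Implicit. Unset Printing Implicit Defensive.
Import Order.TTheory GRing.Theory Num.Theory.
Local Open Scope classical_set_scope.
Local Open Scope ring_scope.

(* ---------- The linearly ordered abelian group X, given by its positive cone *)
Definition pos_cone (X : zmodType) (P : set X) : Prop :=
  [/\ P 0,
      (forall a b, P a -> P b -> P (a + b)),
      (forall a, P a -> P (- a) -> a = 0) &
      (forall a, P a \/ P (- a))].

(* ---------- The dual group G = Hom(X, T) (X discrete) ---------------------- *)
Definition is_char (R : realType) (X : zmodType) (f : X -> R[i]) : Prop :=
  (forall a b, f (a + b) = f a * f b) /\ (forall a, Normc.normc (f a) = 1).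

Definition dualG (R : realType) (X : zmodType) := {f : X -> R[i] | is_char f}.

Lemma is_char1 (R : realType) (X : zmodType) : is_char (fun _ : X => (1 : R[i])).
Proof.
split=> [a b|a]; first by rewrite mulr1.
by rewrite /Normc.normc /= expr0n /= expr1n addr0 sqrtr1.
Qed.

HB.instance Definition _ (R : realType) (X : zmodType) :=
  gen_eqMixin (dualG R X).
HB.instance Definition _ (R : realType) (X : zmodType) :=
  gen_choiceMixin (dualG R X).
HB.instance Definition _ (R : realType) (X : zmodType) :=
  isPointed.Build (dualG R X) (exist _ _ (is_char1 R X)).

Definition pair (R : realType) (X : zmodType) (x : dualG R X) (xi : X) : R[i] :=
  proj1_sig x xi.

(* sigma-algebra on G generated by the characters xi : G -> C (real and     *)
(* imaginary parts); this is the Baire sigma-algebra of the compact group G. *)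
Definition gen_sets (R : realType) (X : zmodType) : set (set (dualG R X)) :=
  [set A | exists (xi : X) (B : set R), measurable B /\
     (A = [set x | B (complex.Re (pair x xi))] \/
      A = [set x | B (complex.Im (pair x xi))])].

Definition Gmeas (R : realType) (X : zmodType) := g_sigma_algebraType (@gen_sets R X).

Definition haar (R : realType) (X : zmodType)
  (mu : {measure set (Gmeas R X) -> \bar R}) : Prop :=
  mu setT = 1%E /\
  forall (g : Gmeas R X) (A : set (Gmeas R X)), measurable A ->
    mu [set x : Gmeas R X | exists2 y : Gmeas R X, A y &
          forall xi, pair x xi = pair g xi * pair y xi] = mu A.

Definition cint (R : realType) (X : zmodType)
  (mu : {measure set (Gmeas R X) -> \bar R}) (f : Gmeas R X -> R[i]) : R[i] :=
  Complex (Rintegral mu setT (fun x => complex.Re (f x)))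
          (Rintegral mu setT (fun x => complex.Im (f x))).

Definition Linf (R : realType) (X : zmodType)
  (mu : {measure set (Gmeas R X) -> \bar R}) (f : Gmeas R X -> R[i]) : Prop :=
  [/\ measurable_fun setT (fun x => complex.Re (f x)),
      measurable_fun setT (fun x => complex.Im (f x)) &
      exists M : R, {ae mu, forall x, Normc.normc (f x) <= M}].

Definition fourier (R : realType) (X : zmodType)
  (mu : {measure set (Gmeas R X) -> \bar R}) (f : Gmeas R X -> R[i]) (xi : X) : R[i] :=
  cint mu (fun x => f x * conjc (pair x xi)).

Definition Hinf (R : realType) (X : zmodType) (P : set X)
  (mu : {measure set (Gmeas R X) -> \bar R}) (f : Gmeas R X -> R[i]) : Prop :=
  Linf mu f /\ forall xi, ~ P xi -> fourier mu f xi = 0.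

(* f is invertible in the Banach algebra H^oo(G) (elements are a.e. classes) *)
Definition Hinf_invertible (R : realType) (X : zmodType) (P : set X)
  (mu : {measure set (Gmeas R X) -> \bar R}) (f : Gmeas R X -> R[i]) : Prop :=
  exists2 h, Hinf P mu h & {ae mu, forall x, f x * h x = 1}.

Definition is_l2 (R : realType) (X : zmodType) (g : X -> R[i]) : Prop :=
  exists M : R, forall F : {fset X}, \sum_(xi <- F) Normc.normc (g xi) ^+ 2 <= M.

Definition is_l2p (R : realType) (X : zmodType) (P : set X) (g : X -> R[i]) : Prop :=
  is_l2 g /\ forall xi, ~ P xi -> g xi = 0.

Definition has_sum (R : realType) (X : zmodType) (a : X -> R[i]) (s : R[i]) : Prop :=
  forall e : R, 0 < e -> exists F0 : {fset X}, forall F : {fset X},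
    (F0 `<=` F)%fset -> Normc.normc (\sum_(xi <- F) a xi - s) < e.

Definition check_is (R : realType) (X : zmodType)
  (mu : {measure set (Gmeas R X) -> \bar R}) (k : X -> R[i]) (f : Gmeas R X -> R[i])
  : Prop :=
  forall e : R, 0 < e -> exists F0 : {fset X}, forall F : {fset X},
    (F0 `<=` F)%fset ->
    (\int[mu]_x ((Normc.normc (f x - \sum_(xi <- F) k xi * pair x xi)) ^+ 2)%:E
       < e%:E)%E.

(* graph relation: Wrel g h  <->  W_k g = h *)
Definition Wrel (R : realType) (X : zmodType) (P : set X) (k : X -> R[i])
  (g h : X -> R[i]) : Prop :=
  forall xi, (P xi -> has_sum (fun eta => k (xi - eta) * g eta) (h xi)) /\
             (~ P xi -> h xi = 0).

(* graph of W_k - lambda I *)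
Definition Wshift (R : realType) (X : zmodType) (P : set X) (k : X -> R[i])
  (lam : R[i]) (g h : X -> R[i]) : Prop :=
  Wrel P k g (fun xi => h xi + lam * g xi).

Definition op_invertible (R : realType) (X : zmodType) (P : set X)
  (T : (X -> R[i]) -> (X -> R[i]) -> Prop) : Prop :=
  (forall h, is_l2p P h -> exists g, [/\ is_l2p P g, T g h &
       forall g', is_l2p P g' -> T g' h -> g' = g]) /\
  exists C : R, forall g h, is_l2p P g -> is_l2p P h -> T g h ->
    forall M : R, (forall F : {fset X}, \sum_(xi <- F) Normc.normc (h xi) ^+ 2 <= M) ->
    forall F : {fset X}, \sum_(xi <- F) Normc.normc (g xi) ^+ 2 <= C * M.

(* Main.v *)
Require Import Defs.
From HB Require Import structures.
From mathcomp Require Import all_boot all_order all_algebra.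
From mathcomp Require Import finmap.
From mathcomp Require Import all_classical all_reals all_analysis.
From mathcomp Require Import measurable_realfun measurable_fun_approximation.
From mathcomp Require Import simple_functions.
From mathcomp.real_closed Require Import complex.
From mathcomp Require Import ring lra.
Set Implicit Arguments. Unset Strict Implicit. Unset Printing Implicit Defensive.
Import Order.TTheory GRing.Theory Num.Theory.
Import numFieldNormedType.Exports.
Local Open Scope classical_set_scope.
Local Open Scope ring_scope.

(* W_k is multiplication by f = \check k on H^2, read on Fourier coefficients:
   since k and g are supported in the cone, so is k * g, and no projection
   occurs.  If h in H^oo inverts f, convolution with the coefficients of h
   inverts W_k.  Conversely, a bounded inverse of W_k gives ||p||_2 <=
   C ||f p||_2 for trigonometric polynomials p with spectrum in the cone; as X
   is linearly ordered and characters are unimodular, multiplying by a character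
   removes the restriction on the spectrum, and by density the bound holds for
   all bounded functions.  Testing it on {|f| < c} shows that |f| is bounded
   below, so h = 1/f is bounded.  If g in l_2(X_+) solves W_k g = delta_0 then g
   consists of the Fourier coefficients of h, whence h is in H^oo.

   The characters are orthogonal because, X being torsion free and the circle
   divisible, every nonzero element of X takes the value -1 at some point of G. *)

(** * Extension of characters of subgroups *)

(** Two obstacles shape the argument. First, [G] carries no topology here, only the sigma-algebra
    generated by the characters, so density of trigonometric polynomials does not pass through
    continuous functions. Instead, the bounded real functions that are [L^2] limits of such
    polynomials form an algebra closed under bounded pointwise limits. Polynomials converging to a
    step function put the indicators of sublevel sets in it, and a sigma-algebra argument then
    reaches every measurable set. Second, only essentially bounded functions are integrated, so a
    sequence in [l_2] is never realised as a function on [G]. Convolution with [hat u] is therefore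
    handled through finite truncations: its norm bound comes from duality, and the cancellation of
    [u] against its reciprocal is checked on truncations and carried over by that bound. The
    spectral statement is the invertibility statement for [f - lam], whose coefficients are [k]
    minus [lam] times the unit mass at [0]. *)

Local Notation normc := Normc.normc.

Section ExtendChar.
Variables (R : realType) (X : zmodType).
Implicit Types (A B : set (X * R[i])).

Lemma normcX (z : R[i]) n : normc (z ^+ n) = normc z ^+ n.
Proof.
by elim: n => [|n IH]; rewrite ?expr0 ?Normc.normc1 // !exprS Normc.normcM IH.
Qed.

Lemma normc_ge0 (z : R[i]) : 0 <= normc z.
Proof. by case: z => a b; exact: sqrtr_ge0. Qed.

Lemma normc_exprz (z : R[i]) (n : int) : normc z = 1 -> normc (z ^ n) = 1.
Proof.
move=> z1; case: n => n /=; first by rewrite -exprnP normcX z1 expr1n.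
by rewrite NegzE -exprnN Normc.normcV normcX z1 expr1n invr1.
Qed.

(** This is the divisibility of the circle. *)
Lemma unit_root (z : R[i]) n : normc z = 1 -> (0 < n)%N ->
  exists2 w : R[i], w ^+ n = z & normc w = 1.
Proof.
move=> z1 n0; exists (n.-root z); first exact: rootCK.
have : normc (n.-root z) ^+ n = 1 by rewrite -normcX rootCK.
by move/eqP; rewrite pexpr_eq1 ?normc_ge0 // => /eqP.
Qed.

(* [A] is the graph of a character of a subgroup of [X]. *)
Definition partial_char A : Prop :=
  [/\ A (0, 1),
      (forall x z y w, A (x, z) -> A (y, w) -> A (x - y, z / w)),
      (forall z, A (0, z) -> z = 1) &
      (forall x z, A (x, z) -> normc z = 1)].

Lemma normc1_neq0 (z : R[i]) : normc z = 1 -> z != 0.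
Proof.
move=> z1; apply/negP => /eqP z0; move: z1; rewrite z0 Normc.normc0 => /eqP.
by rewrite eq_sym oner_eq0.
Qed.

Lemma partial_charN A x z : partial_char A -> A (x, z) -> A (- x, z^-1).
Proof. by move=> [A0 AB _ _] /(AB _ _ _ _ A0); rewrite sub0r div1r. Qed.

Lemma partial_charD A x z y w : partial_char A -> A (x, z) -> A (y, w) ->
  A (x + y, z * w).
Proof.
move=> pA Ax /(partial_charN pA) Ay; case: (pA) => [_ AB _ _].
by have := AB _ _ _ _ Ax Ay; rewrite opprK invrK.
Qed.

Lemma partial_charMz A x z (n : int) : partial_char A -> A (x, z) ->
  A (x *~ n, z ^ n).
Proof.
move=> pA Ax; have H m : A (x *+ m, z ^+ m).
  elim: m => [|m IH]; first by rewrite mulr0n expr0; case: pA.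
  by rewrite mulrS exprS; exact: partial_charD.
case: n => n; first exact: H.
by rewrite NegzE mulrNz -exprnN; apply: partial_charN => //; exact: H.
Qed.

Lemma partial_char_uniq A x z w : partial_char A -> A (x, z) -> A (x, w) ->
  z = w.
Proof.
move=> [_ AB A1 AN] Az Aw; have := AB _ _ _ _ Az Aw; rewrite subrr => /A1 zw.
by rewrite -[w]mul1r -zw divfK // normc1_neq0 //; exact: AN Aw.
Qed.

Definition extend_by A a (z : R[i]) : set (X * R[i]) :=
  [set t | exists x w n, A (x, w) /\ t = (x + a *~ n, w * z ^ n)].

(** The last hypothesis is compatibility on the multiples of [a] already in the domain, and it gives
    single-valuedness: if [x + a *~ n = 0] with [A (x, w)], then [a *~ n = - x] has value [w^-1], so
    [w * z ^ n = 1]. *)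
Lemma extend_by_char A a z : partial_char A -> normc z = 1 ->
  (forall w n, A (a *~ n, w) -> z ^ n = w) -> partial_char (extend_by A a z).
Proof.
move=> pA z1 zA; case: (pA) => [A0 AB A1 AN].
have zn0 := normc1_neq0 z1.
split.
- by exists 0, 1, 0; rewrite mulr0z expr0z addr0 mulr1.
- move=> ? ? ? ? [x [w [n [Axw [-> ->]]]]] [y [v [m [Ayv [-> ->]]]]].
  exists (x - y), (w / v), (n - m); split; first exact: AB.
  congr (_, _); first by rewrite mulrzBr opprD addrACA.
  by rewrite expfzDr // -invr_expz invfM mulrACA.
- move=> ? [x [w [n [Axw [/esym/eqP]]]]].
  rewrite addrC addr_eq0 => /eqP axn ->.
  rewrite (zA w^-1 n) ?divff ?normc1_neq0 //; first exact: AN Axw.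
  by rewrite axn; exact: partial_charN.
- move=> ? ? [x [w [n [Axw [_ ->]]]]].
  by rewrite Normc.normcM normc_exprz // mulr1; exact: AN Axw.
Qed.

(** The integers [n] with [a *~ n] in the domain form a subgroup of the integers. If it is trivial,
    any unimodular [z] works and [1] is taken; otherwise [z] is an [m]-th root of the value at
    [a *+ m], for [m] the least positive element. *)
Lemma extend_value A a : partial_char A -> exists z : R[i],
  normc z = 1 /\ forall w n, A (a *~ n, w) -> z ^ n = w.
Proof.
move=> pA; case: (pA) => [A0 AB A1 AN].
have [[n0 [n0_gt0 [w0 Aw0]]]|noA] :=
  pselect (exists n : nat, (0 < n)%N /\ exists w, A (a *+ n, w)); last first.
  exists 1; split; first exact: Normc.normc1.
  move=> w [[|n]|n] Aw.
  - by move: Aw; rewrite mulr0z expr0z => /A1.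
  - by case: noA; exists n.+1; split => //; exists w.
  - case: noA; exists n.+1; split => //; exists w^-1.
    by move/(partial_charN pA): Aw; rewrite NegzE mulrNz opprK.
pose Q n := `[< (0 < n)%N /\ exists w, A (a *+ n, w) >].
have exQ : exists n, Q n by exists n0; apply/asboolP; split=> //; exists w0.
case: (ex_minnP exQ) => m /asboolP [m0 [v Av]] mmin.
have [z zv z1] := unit_root (AN _ _ Av) m0.
exists z; split => // w n Aw.
have zn0 := normc1_neq0 z1.
have mz : (m%:Z != 0) by rewrite eqz_nat -lt0n.
have nE := divz_eq n m.
(* A nonzero remainder would be a positive element of [Q] below the minimum [m]. *)
have r0 : (n %% m)%Z = 0.
  have := ltz_mod n mz; have := modz_ge0 n mz.
  case E : (n %% m)%Z => [r|r] //= _ rm.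
  case: r E rm => [//|r] E; rewrite ltz_nat => rm.
  have /mmin : Q r.+1.
    apply/asboolP; split=> //.
    exists (w / (v ^ (n %/ m)%Z)).
    have -> : a *+ r.+1 = a *~ n - (a *+ m) *~ (n %/ m)%Z.
      have {1}-> : n = m%:Z * (n %/ m)%Z + r.+1 by rewrite mulrC -E.
      by rewrite mulrzDr mulrzA [X in X - _]addrC addrK.
    by apply: AB => //; exact: partial_charMz.
  by rewrite leqNgt rm.
rewrite r0 addr0 in nE.
rewrite nE mulrC -exprz_exp -exprnP zv.
apply: (partial_char_uniq pA _ Aw).
by rewrite {1}nE mulrC mulrzA; exact: partial_charMz.
Qed.

(* Zorn's lemma: the circle is divisible, hence injective. *)
Lemma partial_char_extends A : partial_char A ->
  exists2 f : X -> R[i], is_char f & forall x z, A (x, z) -> f x = z.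
Proof.
move=> pA.
pose Pc B := B = set0 \/ (partial_char B /\ A `<=` B).
have [F FP Ftot|M [PM Mmax]] := @Zorn_bigcup _ Pc.
  have [allE|] := pselect (forall B, F B -> B = set0).
    left; apply/seteqP; split=> // t [B FB Bt].
    by rewrite (allE _ FB) in Bt.
  move=> /existsNP [B0 /not_implyP [FB0 B0n]].
  have good B : F B -> B !=set0 -> partial_char B /\ A `<=` B.
    by move=> /FP [->|//] [].
  have [pB0 AB0] : partial_char B0 /\ A `<=` B0.
    by apply: good => //; apply/set0P/eqP.
  right; split; last by move=> t /AB0 ?; exists B0.
  split.
  - by exists B0 => //; case: pB0.
  - move=> x z y w [B FB Bx] [C FC Cy].
    have [BC|CB] := Ftot _ _ FB FC.
      exists C => //; have [[_ CB _ _] _] : partial_char C /\ A `<=` C.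
        by apply: good => //; exists (y, w).
      by apply: CB => //; exact: BC.
    exists B => //; have [[_ BB _ _] _] : partial_char B /\ A `<=` B.
      by apply: good => //; exists (x, z).
    by apply: BB => //; exact: CB.
  - move=> z [B FB Bz]; have [[_ _ B1 _] _] : partial_char B /\ A `<=` B.
      by apply: good => //; exists (0, z).
    exact: B1.
  - move=> x z [B FB Bz]; have [[_ _ _ BN] _] : partial_char B /\ A `<=` B.
      by apply: good => //; exists (x, z).
    exact: BN Bz.
have A01 : A (0, 1) by case: pA.
have {PM} [pM AM] : partial_char M /\ A `<=` M.
  case: PM => // M0; exfalso; apply: (Mmax A); last by right; split.
  by rewrite M0; split; [exact: sub0set|move=> /(_ _ A01)].
have domM x : exists z, M (x, z).
  apply: contrapT => nM.
  have [z [z1 zM]] := extend_value x pM.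
  apply: (Mmax (extend_by M x z)); last first.
    right; split; first exact: extend_by_char.
    move=> [y w] /AM My; exists y, w, 0.
    by rewrite mulr0z expr0z addr0 mulr1.
  split.
    move=> [y w] My; exists y, w, 0.
    by rewrite mulr0z expr0z addr0 mulr1.
  move=> /(_ (x, z)) eM; apply: nM; exists z; apply: eM.
  exists 0, 1, 1; rewrite mulr1z expr1z add0r mul1r.
  by split=> //; case: pM.
have [f fM] := choice domM.
exists f; last by move=> x z /AM; exact: partial_char_uniq pM (fM x).
split.
  move=> a b; apply: (partial_char_uniq pM (fM _)).
  exact: partial_charD (fM a) (fM b).
by move=> a; case: pM => _ _ _ /(_ _ _ (fM a)).
Qed.

(** Up to sign [a] lies in the cone; then [- a = a *+ n] lies in it too, and antisymmetry gives
    [a = 0]. *)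
Lemma pos_cone_torsion_free (P : set X) (a : X) n : pos_cone P ->
  a *+ n.+1 = 0 -> a = 0.
Proof.
move=> [P0 PD PN Ptot].
have PM b m : P b -> P (b *+ m).
  by move=> Pb; elim: m => [//|m IH]; rewrite mulrS; exact: PD.
wlog Pa : a / P a.
  move=> H; have [Pa|Pa] := Ptot a; first exact: H.
  move=> an; apply/eqP; rewrite -oppr_eq0; apply/eqP; apply: H => //.
  by rewrite mulNrn an oppr0.
rewrite mulrS => /eqP; rewrite addrC addr_eq0 => /eqP an.
by apply: PN => //; rewrite -an; exact: PM.
Qed.

(** As [a] has infinite order, sending [a *~ n] to [(-1) ^ n] is well defined, and it extends to
    [X]. The real value [-1], rather than just some value other than [1], lets orthogonality be
    checked separately on real and imaginary parts. *)
Lemma char_with_value_N1 (P : set X) (a : X) : pos_cone P -> a != 0 ->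
  exists2 f : X -> R[i], is_char f & f a = -1.
Proof.
move=> hP a0.
have N11 : normc (-1 : R[i]) = 1.
  by rewrite /Normc.normc /= oppr0 expr0n addr0 sqrrN expr1n sqrtr1.
have n0 n : a *~ n = 0 -> n = 0.
  case: n => [[//|n]|n].
    by move=> /(pos_cone_torsion_free hP) /eqP; rewrite (negbTE a0).
  rewrite NegzE mulrNz => /eqP; rewrite oppr_eq0 => /eqP.
  by move=> /(pos_cone_torsion_free hP) /eqP; rewrite (negbTE a0).
have pT : partial_char [set (0 : X, 1 : R[i])].
  split=> //.
  - by move=> x z y w [-> ->] [-> ->] /=; rewrite subrr divr1.
  - by move=> z [].
  - by move=> x z [_ ->]; exact: Normc.normc1.
have zA w n : [set (0 : X, 1 : R[i])] (a *~ n, w) -> (-1 : R[i]) ^ n = w.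
  by move=> [/n0 -> ->]; rewrite expr0z.
have [f fc fA] := partial_char_extends (extend_by_char pT N11 zA).
exists f => //; apply: fA; exists 0, 1, 1.
by rewrite mulr1z expr1z add0r mul1r.
Qed.

End ExtendChar.

(** * Bounded measurable functions on the dual group *)

Local Notation re := (@complex.Re _).
Local Notation im := (@complex.Im _).
Local Notation "x %:C" := (Complex x 0).

(** * Real and imaginary parts, squared modulus *)

Section ComplexParts.
Variable R : realType.
Implicit Types x y z w : R[i].

(** The squared modulus without the square root: a polynomial in the two parts, so that its
    identities are ring identities. *)
Definition sqn z : R := re z ^+ 2 + im z ^+ 2.

Lemma reD x y : re (x + y) = re x + re y. Proof. by case: x y => [? ?] []. Qed.
Lemma imD x y : im (x + y) = im x + im y. Proof. by case: x y => [? ?] []. Qed.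
Lemma reN x : re (- x) = - re x. Proof. by case: x. Qed.
Lemma imN x : im (- x) = - im x. Proof. by case: x. Qed.
Lemma reM x y : re (x * y) = re x * re y - im x * im y.
Proof. by case: x y => [? ?] []. Qed.
Lemma imM x y : im (x * y) = re x * im y + im x * re y.
Proof. by case: x y => [? ?] []. Qed.
Lemma reJ x : re (conjc x) = re x. Proof. by case: x. Qed.
Lemma imJ x : im (conjc x) = - im x. Proof. by case: x. Qed.

Definition reimE := (reD, imD, reN, imN, reM, imM, reJ, imJ).

Lemma complex_eq x y : re x = re y -> im x = im y -> x = y.
Proof. by case: x y => [? ?] [? ?] /= -> ->. Qed.

Lemma normc2 z : normc z ^+ 2 = sqn z.
Proof. by case: z => a b; rewrite /= sqr_sqrtr // addr_ge0 // sqr_ge0. Qed.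

Lemma sqn_ge0 z : 0 <= sqn z. Proof. by rewrite addr_ge0 // sqr_ge0. Qed.

Lemma sqn_eq0 z : sqn z = 0 -> z = 0.
Proof.
move=> /eqP; rewrite paddr_eq0 ?sqr_ge0 // !sqrf_eq0 => /andP[/eqP a /eqP b].
exact: complex_eq.
Qed.

Lemma sqn0 : sqn 0 = 0. Proof. by rewrite /sqn /= expr0n addr0. Qed.

Lemma sqnM x y : sqn (x * y) = sqn x * sqn y.
Proof. by rewrite /sqn !reimE; ring. Qed.

Lemma sqnN x : sqn (- x) = sqn x.
Proof. by rewrite /sqn !reimE; ring. Qed.

Lemma sqnJ x : sqn (conjc x) = sqn x.
Proof. by rewrite /sqn !reimE; ring. Qed.

(** The difference of the two sides is [sqn (x - y)] (parallelogram law). *)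
Lemma sqn_le2 x y : sqn (x + y) <= 2 * sqn x + 2 * sqn y.
Proof.
rewrite /sqn !reimE -subr_ge0.
rewrite [leRHS](_ : _ = (re x - re y) ^+ 2 + (im x - im y) ^+ 2); last by ring.
by rewrite addr_ge0 // sqr_ge0.
Qed.

Lemma reMJ z : re (z * conjc z) = sqn z.
Proof. by rewrite !reimE /sqn; ring. Qed.

Lemma imMJ z : im (z * conjc z) = 0.
Proof. by rewrite !reimE; ring. Qed.

Lemma mulJ z : z * conjc z = (sqn z)%:C.
Proof. by apply: complex_eq; rewrite ?reMJ ?imMJ. Qed.

Lemma normc_le_sqn z (M : R) : 0 <= M -> (normc z <= M) = (sqn z <= M ^+ 2).
Proof. by move=> M0; rewrite -normc2 ler_sqr ?nnegrE // normc_ge0. Qed.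

Lemma normc_lt_sqn z (M : R) : 0 <= M -> (normc z < M) = (sqn z < M ^+ 2).
Proof. by move=> M0; rewrite -normc2 ltr_sqr ?nnegrE // normc_ge0. Qed.

Lemma re_le_normc z : `|re z| <= normc z.
Proof.
by case: z => a b /=; rewrite -sqrtr_sqr ler_wsqrtr // lerDl sqr_ge0.
Qed.

Lemma im_le_normc z : `|im z| <= normc z.
Proof.
by case: z => a b /=; rewrite -sqrtr_sqr ler_wsqrtr // lerDr sqr_ge0.
Qed.

Lemma normc_le_reim z : normc z <= `|re z| + `|im z|.
Proof.
rewrite normc_le_sqn ?addr_ge0 // /sqn sqrrD !real_normK ?num_real //.
by rewrite lerD2r lerDl mulrn_wge0 // mulr_ge0.
Qed.

Lemma re_sum (I : Type) (s : seq I) (F : I -> R[i]) :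
  re (\sum_(i <- s) F i) = \sum_(i <- s) re (F i).
Proof. by elim: s => [|i s IH]; rewrite ?big_nil // !big_cons reD IH. Qed.

Lemma im_sum (I : Type) (s : seq I) (F : I -> R[i]) :
  im (\sum_(i <- s) F i) = \sum_(i <- s) im (F i).
Proof. by elim: s => [|i s IH]; rewrite ?big_nil // !big_cons imD IH. Qed.

Lemma conjcM x y : conjc (x * y) = conjc x * conjc y.
Proof. by apply: complex_eq; rewrite !reimE; ring. Qed.

Lemma conjc_sum (I : Type) (s : seq I) (F : I -> R[i]) :
  conjc (\sum_(i <- s) F i) = \sum_(i <- s) conjc (F i).
Proof.
by apply: complex_eq; rewrite !reimE ?re_sum ?im_sum ?sumrN -?sumrN;
  apply: eq_bigr => i _; rewrite !reimE.
Qed.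

End ComplexParts.

Section BoundedIntegral.
Variables (R : realType) (X : zmodType) (mu : {measure set (Gmeas R X) -> \bar R}).
Hypothesis mu1 : mu setT = 1%E.
Local Notation G := (Gmeas R X).
Implicit Types (g h : G -> R) (u v w : G -> R[i]).

(** Real [L^oo]. Since [mu] has total mass one, these functions are all integrable, and they form an
    algebra, so no integrability conditions need to be carried along. *)
Definition bm g := measurable_fun setT g /\
  exists M : R, {ae mu, forall x, `|g x| <= M}.

Lemma bm_ge0 g : bm g -> exists2 M : R, 0 <= M & {ae mu, forall x, `|g x| <= M}.
Proof.
move=> [_ [M gM]]; exists `|M|; first exact: normr_ge0.
by apply: filterS gM => x /le_trans; apply; exact: ler_norm.
Qed.

Lemma bm_integrable g : bm g -> mu.-integrable setT (EFin \o g).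
Proof.
move=> bg; have [M M0 gM] := bm_ge0 bg; case: bg => mg _.
apply/integrableP; split; first exact/measurable_EFinP.
apply: (@le_lt_trans _ _ (\int[mu]_x (cst M%:E) x)%E).
  apply: ae_ge0_le_integral => //.
  - apply: measurableT_comp => //; exact/measurable_EFinP.
  - by apply: filterS gM => x gx _; rewrite /= lee_fin.
by rewrite integral_cst // mu1 mule1 ltry.
Qed.

Lemma bm_cst c : bm (cst c).
Proof. by split; [exact: measurable_cst|exists `|c|; exact: aeW]. Qed.

Lemma bmD g h : bm g -> bm h -> bm (fun x => g x + h x).
Proof.
move=> [mg [M gM]] [mh [N hN]]; split; first exact: measurable_funD.
exists (M + N); apply: filterS2 gM hN => x gx hx.
by apply: le_trans (ler_normD _ _) _; exact: lerD.
Qed.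

Lemma bmM g h : bm g -> bm h -> bm (fun x => g x * h x).
Proof.
move=> [mg [M gM]] [mh [N hN]]; split; first exact: measurable_funM.
exists (M * N); apply: filterS2 gM hN => x gx hx.
by rewrite normrM; exact: ler_pM.
Qed.

Lemma bmN g : bm g -> bm (fun x => - g x).
Proof.
move=> [mg [M gM]]; split; first exact: measurable_funN.
by exists M; apply: filterS gM => x; rewrite normrN.
Qed.

Lemma bmB g h : bm g -> bm h -> bm (fun x => g x - h x).
Proof. by move=> bg bh; apply: bmD => //; exact: bmN. Qed.

Lemma bmZ c g : bm g -> bm (fun x => c * g x).
Proof. by move=> bg; apply: bmM => //; exact: bm_cst. Qed.

Lemma bm_sqr g : bm g -> bm (fun x => g x ^+ 2).
Proof. by move=> bg; have := bmM bg bg. Qed.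

Local Notation rint := (Rintegral mu setT).

Lemma rintD g h : bm g -> bm h -> rint (fun x => g x + h x) = rint g + rint h.
Proof. by move=> bg bh; rewrite RintegralD //; exact: bm_integrable. Qed.

Lemma rintB g h : bm g -> bm h -> rint (fun x => g x - h x) = rint g - rint h.
Proof. by move=> bg bh; rewrite RintegralB //; exact: bm_integrable. Qed.

Lemma rintZ c g : bm g -> rint (fun x => c * g x) = c * rint g.
Proof. by move=> bg; rewrite RintegralZl //; exact: bm_integrable. Qed.

Lemma rintN g : bm g -> rint (fun x => - g x) = - rint g.
Proof.
move=> bg; rewrite -mulN1r -rintZ //; congr (Rintegral _ _ _).
by apply/funext => x; rewrite mulN1r.
Qed.

Lemma rint_cst c : rint (cst c) = c.
Proof. by rewrite Rintegral_cst // mu1 mulr1. Qed.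

Lemma rint_ge0 g : (forall x, 0 <= g x) -> 0 <= rint g.
Proof. by move=> g0; exact: Rintegral_ge0. Qed.

Lemma rint_ae g h : bm g -> bm h -> {ae mu, forall x, g x = h x} ->
  rint g = rint h.
Proof.
move=> [mg _] [mh _] gh; rewrite /Rintegral; congr fine.
apply: ae_eq_integral => //; [exact/measurable_EFinP|exact/measurable_EFinP|].
by apply: filterS gh => x -> _.
Qed.

Lemma bm_eq g h : (forall x, g x = h x) -> bm g -> bm h.
Proof. by move=> /funext ->. Qed.

Lemma bm_max g h : bm g -> bm h -> bm (fun x => Num.max (g x) (h x)).
Proof.
move=> [mg [M gM]] [mh [N hN]]; split; first exact: measurable_maxr.
exists (Num.max M N); apply: filterS2 gM hN => x gx hx.
by rewrite le_max; have [_|_] := leP (g x) (h x); rewrite ?gx ?hx ?orbT.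
Qed.

Lemma rint_le g h : bm g -> bm h -> {ae mu, forall x, g x <= h x} ->
  rint g <= rint h.
Proof.
move=> bg bh gh.
(* The maximum equals [h] almost everywhere and dominates [g] everywhere, which reduces the claim to
   pointwise monotonicity. *)
rewrite (@rint_ae h (fun x => Num.max (g x) (h x))) //; last 2 first.
- exact: bm_max.
- by apply: filterS gh => x gx; rewrite max_r.
apply: le_Rintegral => //; try exact: bm_integrable.
- by apply: bm_integrable; exact: bm_max.
- by move=> x _; rewrite le_max lexx.
Qed.

Lemma LinfP u : Linf mu u <-> bm (fun x => re (u x)) /\ bm (fun x => im (u x)).
Proof.
split=> [[mr mi [M uM]]|[[mr [M rM]] [mi [N iN]]]].
  split; split=> //; exists M; apply: filterS uM => x.
    by apply: le_trans; exact: re_le_normc.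
  by apply: le_trans; exact: im_le_normc.
split=> //; exists (M + N); apply: filterS2 rM iN => x rx ix.
by apply: le_trans (normc_le_reim _) _; exact: lerD.
Qed.

Lemma Linf_eq u v : (forall x, u x = v x) -> Linf mu u -> Linf mu v.
Proof. by move=> /funext ->. Qed.

Lemma LinfD u v : Linf mu u -> Linf mu v -> Linf mu (fun x => u x + v x).
Proof.
move=> /LinfP[ur ui] /LinfP[vr vi]; apply/LinfP; split.
  by apply: (bm_eq _ (bmD ur vr)) => x; rewrite reD.
by apply: (bm_eq _ (bmD ui vi)) => x; rewrite imD.
Qed.

Lemma LinfN u : Linf mu u -> Linf mu (fun x => - u x).
Proof.
move=> /LinfP[ur ui]; apply/LinfP; split.
  by apply: (bm_eq _ (bmN ur)) => x; rewrite reN.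
by apply: (bm_eq _ (bmN ui)) => x; rewrite imN.
Qed.

Lemma LinfB u v : Linf mu u -> Linf mu v -> Linf mu (fun x => u x - v x).
Proof. by move=> Lu Lv; apply: LinfD => //; exact: LinfN. Qed.

Lemma LinfM u v : Linf mu u -> Linf mu v -> Linf mu (fun x => u x * v x).
Proof.
move=> /LinfP[ur ui] /LinfP[vr vi]; apply/LinfP; split.
  by apply: (bm_eq _ (bmB (bmM ur vr) (bmM ui vi))) => x; rewrite reM.
by apply: (bm_eq _ (bmD (bmM ur vi) (bmM ui vr))) => x; rewrite imM.
Qed.

Lemma LinfJ u : Linf mu u -> Linf mu (fun x => conjc (u x)).
Proof.
move=> /LinfP[ur ui]; apply/LinfP; split.
  by apply: (bm_eq _ ur) => x; rewrite reJ.
by apply: (bm_eq _ (bmN ui)) => x; rewrite imJ.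
Qed.

Lemma Linf_cst c : Linf mu (fun=> c).
Proof. by apply/LinfP; split; exact: bm_cst. Qed.

Lemma LinfZ c u : Linf mu u -> Linf mu (fun x => c * u x).
Proof. by apply: LinfM; exact: Linf_cst. Qed.

Lemma Linf_real g : bm g -> Linf mu (fun x => (g x)%:C).
Proof. by move=> bg; apply/LinfP; split => //; exact: bm_cst. Qed.

Lemma Linf_sum (I : Type) (s : seq I) (F : I -> G -> R[i]) :
  (forall i, Linf mu (F i)) -> Linf mu (fun x => \sum_(i <- s) F i x).
Proof.
move=> LF; elim: s => [|i s IH].
  by apply: (Linf_eq _ (Linf_cst 0)) => x; rewrite big_nil.
by apply: (Linf_eq _ (LinfD (LF i) IH)) => x; rewrite big_cons.
Qed.

Lemma normc_pair (x : dualG R X) xi : normc (pair x xi) = 1.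
Proof. by case: x => f []. Qed.

Lemma sqn_pair (x : dualG R X) xi : sqn (pair x xi) = 1.
Proof. by rewrite -normc2 normc_pair expr1n. Qed.

Lemma pairD (x : dualG R X) xi eta : pair x (xi + eta) = pair x xi * pair x eta.
Proof. by case: x => f []. Qed.

Lemma pair0 (x : dualG R X) : pair x 0 = 1.
Proof.
have := pairD x 0 0; rewrite addr0 => /eqP; rewrite eq_sym.
have n0 : pair x 0 != 0 by apply: normc1_neq0; exact: normc_pair.
by rewrite -{3}[pair x 0]mulr1 (inj_eq (mulfI n0)) => /eqP.
Qed.

Lemma pairN (x : dualG R X) xi : pair x (- xi) = conjc (pair x xi).
Proof.
have n0 : pair x xi != 0 by apply: normc1_neq0; exact: normc_pair.
apply: (mulfI n0); rewrite -pairD subrr pair0.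
by rewrite mulJ sqn_pair.
Qed.

Lemma pairB (x : dualG R X) xi eta :
  pair x (xi - eta) = pair x xi * conjc (pair x eta).
Proof. by rewrite pairD pairN. Qed.

Lemma measurable_re_pair xi : measurable_fun setT (fun x : G => re (pair x xi)).
Proof.
move=> _ B mB; rewrite setTI; apply: sub_sigma_algebra.
by exists xi, B; split=> //; left.
Qed.

Lemma measurable_im_pair xi : measurable_fun setT (fun x : G => im (pair x xi)).
Proof.
move=> _ B mB; rewrite setTI; apply: sub_sigma_algebra.
by exists xi, B; split=> //; right.
Qed.

Lemma Linf_pair xi : Linf mu (fun x => pair x xi).
Proof.
split; [exact: measurable_re_pair|exact: measurable_im_pair|].
by exists 1; apply: aeW => x; rewrite normc_pair.
Qed.

Definition trig (F : {fset X}) (c : X -> R[i]) (x : G) : R[i] :=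
  \sum_(xi <- F) c xi * pair x xi.

Lemma Linf_trig F c : Linf mu (trig F c).
Proof. by apply: Linf_sum => xi; apply: LinfZ; exact: Linf_pair. Qed.

Lemma cintD u v : Linf mu u -> Linf mu v ->
  cint mu (fun x => u x + v x) = cint mu u + cint mu v.
Proof.
move=> /LinfP[ur ui] /LinfP[vr vi]; apply: complex_eq => /=; rewrite -rintD //.
  by congr (Rintegral _ _ _); apply/funext => x; rewrite reD.
by congr (Rintegral _ _ _); apply/funext => x; rewrite imD.
Qed.

Lemma cintZ c u : Linf mu u -> cint mu (fun x => c * u x) = c * cint mu u.
Proof.
move=> /LinfP[ur ui]; apply: complex_eq; rewrite !reimE /= -!rintZ //.
  rewrite -rintB; [|exact: bmZ..].
  by congr (Rintegral _ _ _); apply/funext => x; rewrite reM.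
rewrite -rintD; [|exact: bmZ..].
by congr (Rintegral _ _ _); apply/funext => x; rewrite imM.
Qed.

Lemma cintJ u : Linf mu u -> cint mu (fun x => conjc (u x)) = conjc (cint mu u).
Proof.
move=> /LinfP[ur ui]; apply: complex_eq; rewrite !reimE /= -?rintN //.
  by congr (Rintegral _ _ _); apply/funext => x; rewrite reJ.
by congr (Rintegral _ _ _); apply/funext => x; rewrite imJ.
Qed.

Lemma cint_cst c : cint mu (fun=> c) = c.
Proof. by apply: complex_eq; rewrite /= rint_cst. Qed.

Lemma cint_ae u v : Linf mu u -> Linf mu v -> {ae mu, forall x, u x = v x} ->
  cint mu u = cint mu v.
Proof.
move=> /LinfP[ur ui] /LinfP[vr vi] uv.
by apply: complex_eq; apply: rint_ae => //; apply: filterS uv => x ->.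
Qed.

Lemma cint_sum (I : Type) (s : seq I) (F : I -> G -> R[i]) :
  (forall i, Linf mu (F i)) ->
  cint mu (fun x => \sum_(i <- s) F i x) = \sum_(i <- s) cint mu (F i).
Proof.
move=> LF; elim: s => [|i s IH].
  rewrite big_nil -[RHS](cint_cst 0); congr cint.
  by apply/funext => x; rewrite big_nil.
rewrite big_cons -IH -cintD //; last exact: Linf_sum.
by congr cint; apply/funext => x; rewrite big_cons.
Qed.

End BoundedIntegral.

(** * Orthogonality of characters and Bessel's inequality *)

Section CauchySchwarz.
Variable R : realType.
Implicit Types (A B : R) (z c : R[i]).

(** Abstract Cauchy-Schwarz: the hypothesis is the expansion of the squared norm of [u - c v], with
    [A] and [B] the squared norms of [u] and [v] and [z] their inner product. The best choice is
    [c = z / B]. *)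
Lemma discriminant_bound A B z : 0 <= B ->
  (forall c, 0 <= A - 2 * re (z * conjc c) + sqn c * B) -> sqn z <= A * B.
Proof.
move=> B0 H; have [B00|Bn0] := eqVneq B 0.
  rewrite B00 mulr0; rewrite leNgt; apply/negP => z0.
  (* With [B = 0] the expression is affine in [c]; this multiple of [z] gives it the value
     [A - (A + 1) = -1]. *)
  have := H (Complex ((A + 1) / (2 * sqn z)) 0 * z).
  rewrite B00 mulr0 addr0 !reimE /=.
  set t := (A + 1) / _.
  have -> : 2 * (re z * (t * re z - 0 * im z) - im z * - (t * im z + 0 * re z))
    = t * (2 * sqn z) by rewrite /sqn; ring.
  rewrite /t divfK; last by rewrite mulf_neq0 ?pnatr_eq0 // gt_eqF.
  by rewrite opprD addrA subrr sub0r oppr_ge0 ler10.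
have {Bn0}B1 : 0 < B by rewrite lt_def Bn0.
have := H (Complex B^-1 0 * z).
rewrite sqnM {1}/sqn !reimE /= expr0n addr0.
have -> : 2 * (re z * (B^-1 * re z - 0 * im z) - im z * - (B^-1 * im z + 0 * re z))
    = 2 * (B^-1 * sqn z) by rewrite /sqn; ring.
have -> : B^-1 ^+ 2 * sqn z * B = B^-1 * sqn z.
  by rewrite mulrAC expr2 divfK ?gt_eqF.
have -> : A - 2 * (B^-1 * sqn z) + B^-1 * sqn z = A - B^-1 * sqn z by ring.
by rewrite subr_ge0 mulrC ler_pdivrMr.
Qed.

Lemma sum_CauchySchwarz (I : Type) (s : seq I) (a b : I -> R[i]) :
  sqn (\sum_(i <- s) a i * b i) <=
    (\sum_(i <- s) sqn (a i)) * (\sum_(i <- s) sqn (b i)).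
Proof.
apply: discriminant_bound => [|c]; first by apply: sumr_ge0 => i _; exact: sqn_ge0.
rewrite mulr_suml re_sum !mulr_sumr -sumrB -big_split /=.
apply: sumr_ge0 => i _.
suff -> : sqn (a i) - 2 * re (a i * b i * conjc c) + sqn c * sqn (b i) =
  sqn (a i - c * conjc (b i)) by exact: sqn_ge0.
by rewrite /sqn !reimE; ring.
Qed.

End CauchySchwarz.

(** * Translation invariance and orthogonality of characters *)

Section Orthogonality.
Variables (R : realType) (X : zmodType) (mu : {measure set (Gmeas R X) -> \bar R}).
Local Notation G := (Gmeas R X).

Lemma dualG_ext (x y : dualG R X) : (forall xi, pair x xi = pair y xi) -> x = y.
Proof. by case: x y => [f ?] [g ?] fg; apply: eq_exist; exact/funext. Qed.

Lemma is_charM (g x : dualG R X) : is_char (fun xi => pair g xi * pair x xi).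
Proof.
split=> [a b|a]; first by rewrite !pairD mulrACA.
by rewrite Normc.normcM !normc_pair mulr1.
Qed.

Definition translate (g x : G) : G := exist _ _ (is_charM g x).

Lemma is_charJ (g : dualG R X) : is_char (fun xi => conjc (pair g xi)).
Proof.
split=> [a b|a]; first by rewrite !pairD rmorphM.
by rewrite -pairN normc_pair.
Qed.

Definition inverse (g : G) : G := exist _ _ (is_charJ g).

Lemma pair_translate g x xi : pair (translate g x) xi = pair g xi * pair x xi.
Proof. by []. Qed.

Lemma measurable_translate g : measurable_fun setT (translate g).
Proof.
apply: (@measurability _ _ G G setT (translate g) (@gen_sets R X : set (set G))) => //.
move=> _ [_ [xi [B [mB [->|->]]]] <-].
- rewrite [X in measurable X](_ : _ = setT `&`
    (fun x : G => re (pair g xi) * re (pair x xi) - im (pair g xi) * im (pair x xi))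
      @^-1` B); last first.
    by congr (_ `&` _); apply/seteqP; split=> x /=; rewrite reM.
  have := measurable_re_pair (R := R) xi; have := measurable_im_pair (R := R) xi.
  by move=> mi mr; apply: measurable_funB => //; exact: measurable_funM.
- rewrite [X in measurable X](_ : _ = setT `&`
    (fun x : G => re (pair g xi) * im (pair x xi) + im (pair g xi) * re (pair x xi))
      @^-1` B); last first.
    by congr (_ `&` _); apply/seteqP; split=> x /=; rewrite imM.
  have := measurable_re_pair (R := R) xi; have := measurable_im_pair (R := R) xi.
  by move=> mi mr; apply: measurable_funD => //; exact: measurable_funM.
Qed.

Hypothesis hmu : haar mu.
Let mu1 : mu setT = 1%E. Proof. by case: hmu. Qed.

(** The hypothesis [haar] speaks of translated images; the preimage under translation by [g] is the
    image under translation by [inverse g]. *)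
Lemma haar_translate g (A : set G) : measurable A -> mu (translate g @^-1` A) = mu A.
Proof.
move=> mA; case: hmu => _ /(_ (inverse g) _ mA) <-; congr (mu _).
have gg xi : conjc (pair g xi) * pair g xi = 1.
  by rewrite mulrC mulJ sqn_pair.
apply/seteqP; split=> x /=.
  move=> Ax; exists (translate g x) => // xi.
  by rewrite pair_translate mulrA [pair (inverse g) xi * _]gg mul1r.
move=> [y Ay xy]; rewrite (_ : translate g x = y) //.
by apply: dualG_ext => xi; rewrite pair_translate xy mulrA mulrC
  [pair g xi * _]mulrC [_ * pair g xi]gg mulr1.
Qed.

Lemma rint_translate g (h : G -> R) : measurable_fun setT h ->
  (forall x, `|h x| <= 1) ->
  Rintegral mu setT (h \o translate g) = Rintegral mu setT h.
Proof.
move=> mh h1; have mt := measurable_translate g.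
have bht : bm mu (h \o translate g).
  split; first exact: measurableT_comp.
  by exists 1; apply: aeW => x; exact: h1.
rewrite /Rintegral; congr fine.
have mEh : measurable_fun setT (EFin \o h) by exact/measurable_EFinP.
transitivity (\int[mu]_(x in translate g @^-1` setT) ((EFin \o h) \o translate g) x)%E.
  by [].
rewrite -integral_pushforward //; last exact: bm_integrable.
by apply: eq_measure_integral => A mA _; exact: haar_translate.
Qed.

(** For [xi != 0], translating by a point where [xi] takes the value [-1] reverses the sign of both
    parts of the character, so by invariance each integral equals its own opposite. *)
Lemma cint_pair (P : set X) : pos_cone P -> forall xi,
  cint mu (fun x => pair x xi) = (xi == 0)%:R.
Proof.
move=> hP xi; have [->|xi0] := eqVneq xi 0.
  rewrite -(cint_cst mu1 1); congr cint.
  by apply/funext => x; rewrite pair0.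
have [f fc fN1] := char_with_value_N1 R hP xi0.
pose g : G := exist _ f fc.
have /LinfP[br bi] := Linf_pair mu xi.
have half (h : G -> R) : bm mu h -> (forall x, `|h x| <= 1) ->
    (forall x, h (translate g x) = - h x) ->
    Rintegral mu setT h = 0.
  move=> bh h1 hN; have := rint_translate g (proj1 bh) h1.
  have -> : h \o translate g = (fun x => - h x) by apply/funext => x /=; exact: hN.
  rewrite rintN // => /eqP; rewrite eq_sym -subr_eq0 opprK -mulr2n mulrn_eq0 /=.
  by move=> /eqP.
have gN x : pair (translate g x) xi = - pair x xi.
  by rewrite pair_translate /pair /= fN1 mulN1r.
apply: complex_eq => /=; rewrite half // => x; rewrite ?gN ?reN ?imN //.
  by rewrite -(normc_pair x xi) re_le_normc.
by rewrite -(normc_pair x xi) im_le_normc.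
Qed.

End Orthogonality.

(** * The [L^2] inner product, Bessel's inequality and best approximation *)

Section Bessel.
Variables (R : realType) (X : zmodType) (P : set X) (hP : pos_cone P).
Variables (mu : {measure set (Gmeas R X) -> \bar R}) (hmu : haar mu).
Local Notation G := (Gmeas R X).
Local Notation Linf := (Linf mu).
Local Notation hat := (fourier mu).
Implicit Types (u v w : G -> R[i]) (F : {fset X}) (c : X -> R[i]).
Let mu1 : mu setT = 1%E. Proof. by case: hmu. Qed.

Definition ip u v : R[i] := cint mu (fun x => u x * conjc (v x)).
Definition normL2sq u : R := Rintegral mu setT (fun x => sqn (u x)).

Local Notation nsq := normL2sq.

Lemma bm_sqn u : Linf u -> bm mu (fun x => sqn (u x)).
Proof. by move=> /LinfP[ur ui]; apply: bmD; exact: bm_sqr. Qed.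

Lemma nsq_ge0 u : 0 <= nsq u.
Proof. by apply: rint_ge0 => x; exact: sqn_ge0. Qed.

Lemma ip_self u : Linf u -> ip u u = Complex (nsq u) 0.
Proof.
move=> Lu; apply: complex_eq => /=; rewrite /normL2sq.
  by congr (Rintegral _ _ _); apply/funext => x; rewrite reMJ.
rewrite -(rint_cst mu1 0).
by congr (Rintegral _ _ _); apply/funext => x; rewrite imMJ.
Qed.

Lemma ipC u v : Linf u -> Linf v -> ip v u = conjc (ip u v).
Proof.
move=> Lu Lv; rewrite -cintJ //; last by apply: LinfM => //; exact: LinfJ.
by congr cint; apply/funext => x; rewrite rmorphM /= conjcK mulrC.
Qed.

Lemma ipDl u v w : Linf u -> Linf v -> Linf w ->
  ip (fun x => u x + v x) w = ip u w + ip v w.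
Proof.
move=> Lu Lv Lw; rewrite -cintD //; [|by apply: LinfM => //; exact: LinfJ..].
by congr cint; apply/funext => x; rewrite mulrDl.
Qed.

Lemma ipZl a u w : Linf u -> Linf w -> ip (fun x => a * u x) w = a * ip u w.
Proof.
move=> Lu Lw; rewrite -cintZ //; last by apply: LinfM => //; exact: LinfJ.
by congr cint; apply/funext => x; rewrite mulrA.
Qed.

Lemma ipBl u v w : Linf u -> Linf v -> Linf w ->
  ip (fun x => u x - v x) w = ip u w - ip v w.
Proof.
move=> Lu Lv Lw; rewrite -mulN1r -ipZl // -ipDl //; last exact: LinfZ.
by congr cint; apply/funext => x; rewrite mulN1r.
Qed.

Lemma ip_trigr u F c : Linf u ->
  ip u (trig F c) = \sum_(xi <- F) conjc (c xi) * hat u xi.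
Proof.
move=> Lu.
have LuJ xi : Linf (fun x => u x * conjc (pair x xi)).
  by apply: LinfM => //; apply: LinfJ; exact: Linf_pair.
transitivity (cint mu (fun x =>
    \sum_(xi <- F) conjc (c xi) * (u x * conjc (pair x xi)))).
  congr cint; apply/funext => x; rewrite /trig rmorph_sum mulr_sumr.
  by apply: eq_bigr => xi _; rewrite rmorphM /= mulrCA.
rewrite cint_sum //; last by move=> xi; exact: LinfZ.
by apply: eq_bigr => xi _; rewrite cintZ.
Qed.

Lemma hatD u v xi : Linf u -> Linf v ->
  hat (fun x => u x + v x) xi = hat u xi + hat v xi.
Proof. by move=> Lu Lv; apply: ipDl => //; exact: Linf_pair. Qed.

Lemma hatB u v xi : Linf u -> Linf v ->
  hat (fun x => u x - v x) xi = hat u xi - hat v xi.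
Proof. by move=> Lu Lv; apply: ipBl => //; exact: Linf_pair. Qed.

Lemma hatZ a u xi : Linf u -> hat (fun x => a * u x) xi = a * hat u xi.
Proof. by move=> Lu; apply: ipZl => //; exact: Linf_pair. Qed.

Lemma hat_ae u v xi : Linf u -> Linf v -> {ae mu, forall x, u x = v x} ->
  hat u xi = hat v xi.
Proof.
move=> Lu Lv uv; apply: cint_ae => //.
- by apply: LinfM => //; apply: LinfJ; exact: Linf_pair.
- by apply: LinfM => //; apply: LinfJ; exact: Linf_pair.
- by apply: filterS uv => x ->.
Qed.

Lemma hat_pair xi eta : hat (fun x => pair x eta) xi = (xi == eta)%:R.
Proof.
rewrite /fourier [X in cint mu X](_ : _ = (fun x => pair x (eta - xi))).
  by rewrite (cint_pair hmu hP) subr_eq0 eq_sym.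
by apply/funext => x; rewrite pairB.
Qed.

Lemma hat_trig F c xi : hat (trig F c) xi = if xi \in F then c xi else 0.
Proof.
have Lp eta := Linf_pair mu eta.
transitivity (\sum_(eta <- F) c eta * hat (fun x => pair x eta) xi).
  rewrite /fourier; transitivity (cint mu (fun x =>
    \sum_(eta <- F) c eta * (pair x eta * conjc (pair x xi)))).
    congr cint; apply/funext => x; rewrite /trig mulr_suml.
    by apply: eq_bigr => eta _; rewrite mulrA.
  have LJ eta : Linf (fun x => pair x eta * conjc (pair x xi)).
    by apply: LinfM => //; exact: LinfJ.
  rewrite cint_sum //; last by move=> eta; exact: LinfZ.
  by apply: eq_bigr => eta _; rewrite cintZ.
under eq_bigr do rewrite hat_pair.
case: ifPn => [xF|xF]; last first.
  rewrite big_seq big1 // => eta eF; case: eqVneq => [xe|_]; last by rewrite mulr0.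
  by rewrite xe eF in xF.
rewrite (big_fsetD1 xi) //= eqxx mulr1 big_seq big1 ?addr0 // => eta.
by rewrite in_fsetD1 eq_sym => /andP[/negbTE -> _]; rewrite mulr0.
Qed.

Lemma nsqB u v : Linf u -> Linf v ->
  nsq (fun x => u x - v x) = nsq u - 2 * re (ip u v) + nsq v.
Proof.
move=> Lu Lv.
have /LinfP[bu _] : Linf (fun x => u x * conjc (v x)).
  by apply: LinfM => //; exact: LinfJ.
have bsu := bm_sqn Lu; have bsv := bm_sqn Lv.
rewrite -rintZ // -rintB //; last exact: bmZ.
rewrite -rintD //; last by apply: bmB => //; exact: bmZ.
by congr (Rintegral _ _ _); apply/funext => x; rewrite /sqn !reimE; ring.
Qed.

Lemma nsqD_le u v : Linf u -> Linf v ->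
  nsq (fun x => u x + v x) <= 2 * nsq u + 2 * nsq v.
Proof.
move=> Lu Lv; have bsu := bm_sqn Lu; have bsv := bm_sqn Lv.
rewrite -!rintZ // -rintD //; [|exact: bmZ..].
apply: rint_le => //.
- exact: bm_sqn (LinfD Lu Lv).
- by apply: bmD; exact: bmZ.
- by apply: aeW => x; exact: sqn_le2.
Qed.

Lemma nsqZ a u : Linf u -> nsq (fun x => a * u x) = sqn a * nsq u.
Proof.
move=> Lu; rewrite -rintZ //; last exact: bm_sqn.
by congr (Rintegral _ _ _); apply/funext => x; rewrite sqnM.
Qed.

Lemma nsq_mul_pair u eta : nsq (fun x => pair x eta * u x) = nsq u.
Proof.
by congr (Rintegral _ _ _); apply/funext => x; rewrite sqnM sqn_pair mul1r.
Qed.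

Lemma nsq_ae u v : Linf u -> Linf v -> {ae mu, forall x, u x = v x} ->
  nsq u = nsq v.
Proof.
move=> Lu Lv uv; apply: rint_ae => //; try exact: bm_sqn.
by apply: filterS uv => x ->.
Qed.

Lemma nsq_mul_bounded u : Linf u -> exists2 m, 0 <= m &
  forall v, Linf v -> nsq (fun x => u x * v x) <= m * nsq v.
Proof.
move=> Lu; have [mr mi [M uM]] := Lu.
exists (M ^+ 2); first exact: sqr_ge0.
move=> v Lv; rewrite -rintZ //; last exact: bm_sqn.
apply: rint_le => //.
- exact: bm_sqn (LinfM Lu Lv).
- by apply: bmZ; exact: bm_sqn.
apply: filterS uM => x ux; rewrite sqnM ler_wpM2r ?sqn_ge0 //.
by rewrite -normc_le_sqn // (le_trans _ ux) // normc_ge0.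
Qed.

Lemma ip_CauchySchwarz u v : Linf u -> Linf v ->
  sqn (ip u v) <= nsq u * nsq v.
Proof.
move=> Lu Lv; apply: discriminant_bound => [|c]; first exact: nsq_ge0.
rewrite -nsqZ // (_ : ip u v * conjc c = ip u (fun x => c * v x)).
  by rewrite -nsqB //; [exact: nsq_ge0|exact: LinfZ].
by rewrite (ipC (LinfZ _ Lv) Lu) ipZl // rmorphM /= mulrC (ipC Lv Lu).
Qed.

Lemma nsq_trig F c : nsq (trig F c) = \sum_(xi <- F) sqn (c xi).
Proof.
have := ip_self (Linf_trig mu F c); rewrite ip_trigr; last exact: Linf_trig.
move=> /(congr1 re) /= <-; rewrite re_sum big_seq [RHS]big_seq.
by apply: eq_bigr => xi xF; rewrite hat_trig xF mulrC reMJ.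
Qed.

(** Completing the square in each coefficient. Hence the Fourier partial sum is the best
    approximation with frequencies in [F], and Bessel's inequality is the case [c = hat u]. *)
Lemma nsqB_trig u F c : Linf u -> nsq (fun x => u x - trig F c x) =
  nsq u - \sum_(xi <- F) sqn (hat u xi) + \sum_(xi <- F) sqn (hat u xi - c xi).
Proof.
move=> Lu; rewrite nsqB //; last exact: Linf_trig.
rewrite ip_trigr // nsq_trig re_sum mulr_sumr -!addrA; congr (_ + _).
rewrite -!sumrN -!big_split /=; apply: eq_bigr => xi _.
by rewrite /sqn !reimE; ring.
Qed.

Lemma Bessel u F : Linf u -> \sum_(xi <- F) sqn (hat u xi) <= nsq u.
Proof.
move=> Lu; have := nsq_ge0 (fun x => u x - trig F (hat u) x).
rewrite nsqB_trig // [X in _ + X]big1 ?addr0 ?subr_ge0 // => xi _.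
by rewrite subrr sqn0.
Qed.

Lemma nsqB_trig_hat u F : Linf u -> nsq (fun x => u x - trig F (hat u) x) =
  nsq u - \sum_(xi <- F) sqn (hat u xi).
Proof.
move=> Lu; rewrite nsqB_trig // [X in _ + X]big1 ?addr0 // => xi _.
by rewrite subrr sqn0.
Qed.

Definition approximable u := forall e : R, 0 < e ->
  exists F c, nsq (fun x => u x - trig F c x) < e.

Lemma sumr_fsubset_le (F1 F2 : {fset X}) (a : X -> R) : (forall xi, 0 <= a xi) ->
  (F1 `<=` F2)%fset -> \sum_(xi <- F1) a xi <= \sum_(xi <- F2) a xi.
Proof.
move=> a0 F12.
rewrite [leLHS](_ : _ = \sum_(xi <- F1) if xi \in F1 then a xi else 0); last first.
  by rewrite big_seq [RHS]big_seq; apply: eq_bigr => xi ->.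
rewrite (big_fset_incl _ F12) => [|xi _ /negbTE -> //].
by apply: ler_sum => xi _; case: ifP.
Qed.

(** Any approximating polynomial may be replaced by the Fourier partial sum on the same frequencies,
    and its error can only decrease when frequencies are added. *)
Lemma approximableP u : Linf u -> approximable u <->
  forall e : R, 0 < e -> exists F0 : {fset X}, forall F, (F0 `<=` F)%fset ->
    nsq (fun x => u x - trig F (hat u) x) < e.
Proof.
move=> Lu; split=> [Au e e0|Au e e0]; last first.
  by have [F0 H] := Au e e0; exists F0, (hat u); exact: H.
have [F0 [c Fc]] := Au e e0; exists F0 => F F0F.
apply: le_lt_trans Fc; rewrite nsqB_trig_hat // nsqB_trig //.
apply: (@le_trans _ _ (nsq u - \sum_(xi <- F0) sqn (hat u xi))).
  by rewrite lerB // sumr_fsubset_le // => xi; exact: sqn_ge0.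
by rewrite lerDl sumr_ge0 // => xi _; exact: sqn_ge0.
Qed.

End Bessel.

(** * Density of trigonometric polynomials *)

Section StepApproximation.
Variable R : realType.

Lemma bernoulli_ge (x : R) m : -1 <= x -> 1 + m%:R * x <= (1 + x) ^+ m.
Proof.
move=> x1; elim: m => [|m IH]; first by rewrite mul0r addr0 expr0.
rewrite exprS; apply: (@le_trans _ _ ((1 + x) * (1 + m%:R * x))).
  rewrite -natr1 -subr_ge0.
  rewrite [leRHS](_ : _ = m%:R * x ^+ 2); last by ring.
  by rewrite mulr_ge0 // sqr_ge0.
by rewrite ler_wpM2l // -lerBlDl sub0r.
Qed.

Lemma cvg_mul_expr (r : R) : 0 <= r -> r < 1 -> (n%:R * r ^+ n) @[n --> \oo] --> (0 : R).
Proof.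
(* As the mean of [1] and [r], [p] satisfies [r <= p * p]. One factor [p ^+ n] absorbs [n] by
   Bernoulli's inequality, the other tends to [0]. *)
move=> r0 r1; pose p := (1 + r) / 2.
have p0 : 0 < p by rewrite /p; lra.
have p1 : p < 1 by rewrite /p; lra.
have rp : r <= p * p.
  by rewrite -subr_ge0 [leRHS](_ : _ = ((1 - r) / 2) ^+ 2) ?sqr_ge0 // /p; field.
pose h := p^-1 - 1.
have h0 : 0 < h by rewrite subr_gt0 invf_gt1.
have bound n : n%:R * p ^+ n <= h^-1.
  have ph : 1 + h = p^-1 by rewrite /h; ring.
  have : 1 + n%:R * h <= (1 + h) ^+ n by apply: bernoulli_ge; lra.
  rewrite ph exprVn => H.
  have {}H : n%:R * h <= 1 / p ^+ n by rewrite div1r; apply: le_trans H; lra.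
  rewrite -[leRHS]mul1r ler_pdivlMr // mulrAC.
  by move: H; rewrite ler_pdivlMr // exprn_gt0.
apply: (@squeeze_cvgr _ _ _ _ (fun=> 0) (fun n => h^-1 * p ^+ n)).
- apply: nearW => n; rewrite mulr_ge0 ?exprn_ge0 //=.
  apply: (@le_trans _ _ (n%:R * (p * p) ^+ n)).
    by rewrite ler_wpM2l // lerXn2r ?nnegrE // mulr_ge0 // ltW.
  by rewrite exprMn mulrA ler_wpM2r // exprn_ge0 // ltW.
- exact: cvg_cst.
- rewrite -(mulr0 h^-1); apply: cvgM; first exact: cvg_cst.
  by apply: cvg_expr; rewrite gtr0_norm.
Qed.

(** A variant of the polynomials [(1 - s ^ n) ^ (2 ^ n)] known from the Brosowski-Deutsch proof of
    the Stone-Weierstrass theorem. *)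
Definition step_poly n (s : R) : R := (1 - s ^+ n) ^+ (n * 2 ^ n).

Lemma step_poly_itv n s : 0 <= s <= 1 -> 0 <= step_poly n s <= 1.
Proof.
move=> /andP[s0 s1]; have sn0 : 0 <= s ^+ n by rewrite exprn_ge0.
have sn1 : s ^+ n <= 1 by rewrite exprn_ile1.
by rewrite /step_poly exprn_ge0 ?exprn_ile1 //; lra.
Qed.

(* The exponent [n * 2 ^ n], rather than [2 ^ n], forces the limit [0] at the
   threshold [1/2] itself. *)
Lemma cvg_step_poly (s : R) : 0 <= s <= 1 ->
  step_poly n s @[n --> \oo] --> (if s < 2^-1 then 1 else 0 : R).
Proof.
move=> s01; have /andP[s0 s1] := s01.
have sn0 n : 0 <= s ^+ n by rewrite exprn_ge0.
have sn1 n : s ^+ n <= 1 by rewrite exprn_ile1.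
have mE n : (n * 2 ^ n)%:R * s ^+ n = n%:R * (2 * s) ^+ n :> R.
  by rewrite natrM natrX -mulrA exprMn.
case: ltP => s2.
  (* Below the threshold [2 * s < 1], and Bernoulli's inequality supplies this lower bound. *)
  apply: (@squeeze_cvgr _ _ _ _ (fun n => 1 - n%:R * (2 * s) ^+ n) (fun=> 1)).
  - apply: nearW => n; have /andP[_ ->] := step_poly_itv n s01.
    rewrite andbT -mE /step_poly -mulrN; apply: bernoulli_ge.
    by rewrite lerN2.
  - rewrite -[X in _ --> X]subr0; apply: cvgB; first exact: cvg_cst.
    by apply: cvg_mul_expr; lra.
  - exact: cvg_cst.
(* With [N = n * 2 ^ n], the product of [step_poly n s] and [(1 + s ^ n) ^ N] is
   [(1 - s ^ (2 n)) ^ N], at most [1]. By Bernoulli and [2 * s >= 1] the second factor is at least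
   [1 + n]. *)
apply: (@squeeze_cvgr _ _ _ _ (fun=> 0) (fun n => n.+1%:R^-1)).
- apply: nearW => n; have /andP[q0 _] := step_poly_itv n s01.
  rewrite q0 /= -[leRHS]mul1r ler_pdivlMr ?ltr0Sn //.
  apply: (@le_trans _ _ (step_poly n s * (1 + s ^+ n) ^+ (n * 2 ^ n))).
    rewrite ler_wpM2l //.
    have : 1 + (n * 2 ^ n)%:R * s ^+ n <= (1 + s ^+ n) ^+ (n * 2 ^ n).
      by apply: bernoulli_ge; have := sn0 n; lra.
    apply: le_trans; rewrite mE -natr1 addrC lerD2l ler_peMr //.
    by rewrite exprn_ege1 //; lra.
  rewrite /step_poly -exprMn exprn_ile1 //.
    by have := sn0 n; have := sn1 n; nra.
  by have := sn0 n; have := sn1 n; nra.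
- exact: cvg_cst.
- exact: cvg_harmonic.
Qed.

End StepApproximation.

(** * The algebra of bounded [L^2] limits of trigonometric polynomials *)

Section Density.
Variables (R : realType) (X : zmodType) (P : set X) (hP : pos_cone P).
Variables (mu : {measure set (Gmeas R X) -> \bar R}) (hmu : haar mu).
Local Notation G := (Gmeas R X).
Local Notation Linf := (Linf mu).
Local Notation hat := (fourier mu).
Local Notation nsq := (normL2sq mu).
Local Notation approximable := (approximable mu).
Local Notation bm := (bm mu).
Implicit Types (u v w : G -> R[i]) (F : {fset X}) (c : X -> R[i]) (g h : G -> R).
Let mu1 : mu setT = 1%E. Proof. by case: hmu. Qed.

Lemma ltr_quarters (a b e : R) : a < e / 4 -> b < e / 4 -> 2 * a + 2 * b < e.
Proof. by move=> ? ?; lra. Qed.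

Lemma nsq0 : nsq (fun=> 0) = 0.
Proof.
rewrite -[RHS](rint_cst mu1 0).
by congr (Rintegral _ _ _); apply/funext => x; rewrite sqn0.
Qed.

Lemma approximable_eq u v : (forall x, u x = v x) -> approximable u -> approximable v.
Proof. by move=> /funext ->. Qed.

Lemma approximable_trig F c : approximable (trig F c).
Proof.
move=> e e0; exists F, c.
by under eq_fun do rewrite subrr; rewrite nsq0.
Qed.

Lemma approximable_closed u : Linf u ->
  (forall e : R, 0 < e -> exists v, [/\ Linf v, approximable v &
    nsq (fun x => u x - v x) < e]) -> approximable u.
Proof.
move=> Lu H e e0; have e4 : 0 < e / 4 by lra.
have [v [Lv Av uv]] := H _ e4; have [F [c vF]] := Av _ e4.
exists F, c.
have -> : (fun x => u x - trig F c x) = (fun x => (u x - v x) + (v x - trig F c x)).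
  by apply/funext => x; ring.
apply: le_lt_trans (nsqD_le hmu _ _) _; [exact: LinfB|apply: LinfB|].
- by [].
- exact: Linf_trig.
- exact: ltr_quarters.
Qed.

Lemma approximable_ae u v : Linf u -> Linf v -> {ae mu, forall x, u x = v x} ->
  approximable u -> approximable v.
Proof.
move=> Lu Lv uv Au; apply: approximable_closed => // e e0; exists u; split=> //.
rewrite (nsq_ae (v := fun=> 0)) ?nsq0 //.
- exact: LinfB.
- exact: Linf_cst.
- by apply: filterS uv => x ->; rewrite subrr.
Qed.

Lemma approximableD u v : Linf u -> Linf v -> approximable u -> approximable v ->
  approximable (fun x => u x + v x).
Proof.
move=> Lu Lv Au Av; have Luv := LinfD Lu Lv.
apply/(approximableP hP hmu) => // e e0; have e4 : 0 < e / 4 by lra.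
have [Fu Hu] := (approximableP hP hmu Lu).1 Au _ e4.
have [Fv Hv] := (approximableP hP hmu Lv).1 Av _ e4.
exists (Fu `|` Fv)%fset => F; rewrite fsubUset => /andP[/Hu hu /Hv hv].
rewrite (_ : (fun x => _) = (fun x => (u x - trig F (hat u) x) +
   (v x - trig F (hat v) x))); last first.
  apply/funext => x.
  have -> : trig F (hat (fun x0 => u x0 + v x0)) x =
      trig F (hat u) x + trig F (hat v) x.
    rewrite /trig -big_split; apply: eq_bigr => xi _ /=.
    by rewrite (hatD hmu) // mulrDl.
  by ring.
apply: le_lt_trans (nsqD_le hmu _ _) _; try (apply: LinfB => //; exact: Linf_trig).
exact: ltr_quarters.
Qed.

Lemma approximableZ a u : Linf u -> approximable u ->
  approximable (fun x => a * u x).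
Proof.
move=> Lu Au e e0.
have b0 : 0 < sqn a + 1 by have := sqn_ge0 a; lra.
have [F [c Fc]] := Au (e / (sqn a + 1)) (divr_gt0 e0 b0).
exists F, (fun xi => a * c xi).
rewrite (_ : (fun x => _) = (fun x => a * (u x - trig F c x))); last first.
  apply/funext => x; rewrite mulrBr; congr (_ - _).
  by rewrite /trig mulr_sumr; apply: eq_bigr => xi _; rewrite mulrA.
rewrite nsqZ //; last by apply: LinfB => //; exact: Linf_trig.
move: Fc; rewrite ltr_pdivlMr // mulrDr mulr1 [_ * sqn a]mulrC => Fc.
by apply: le_lt_trans Fc; rewrite lerDl nsq_ge0.
Qed.

Lemma approximable_cst a : approximable (fun=> a).
Proof.
have := approximable_trig [fset 0]%fset (fun=> a); apply: approximable_eq => x.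
by rewrite /trig big_seq_fset1 pair0 mulr1.
Qed.

Lemma approximable_pair xi : approximable (fun x => pair x xi).
Proof.
have := approximable_trig [fset xi]%fset (fun=> 1); apply: approximable_eq => x.
by rewrite /trig big_seq_fset1 mul1r.
Qed.

Lemma trig_shift F c eta x :
  trig [fset (eta + xi)%R | xi in F]%fset (fun xi => c (xi - eta)) x =
  pair x eta * trig F c x.
Proof.
rewrite /trig big_imfset /=; last by move=> a b _ _ /addrI.
rewrite mulr_sumr; apply: eq_bigr => xi _.
by rewrite addrC addKr pairD; ring.
Qed.

Lemma approximable_mul_pair u eta : approximable u ->
  approximable (fun x => pair x eta * u x).
Proof.
move=> Au e e0; have [F [c Fc]] := Au e e0.
exists [fset (eta + xi)%R | xi in F]%fset, (fun xi => c (xi - eta)).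
rewrite (_ : (fun x => _) = (fun x => pair x eta * (u x - trig F c x))).
  by rewrite nsq_mul_pair.
by apply/funext => x; rewrite trig_shift; ring.
Qed.

Lemma approximable_sum (I : Type) (s : seq I) (f : I -> G -> R[i]) :
  (forall i, Linf (f i)) -> (forall i, approximable (f i)) ->
  approximable (fun x => \sum_(i <- s) f i x).
Proof.
move=> Lf Af; elim: s => [|i s IH].
  by apply: approximable_eq (approximable_cst 0) => x; rewrite big_nil.
apply: approximable_eq (approximableD (Lf i) (Linf_sum _ Lf) (Af i) IH) => x.
by rewrite big_cons.
Qed.

Lemma approximable_mul_trig u F c : Linf u -> approximable u ->
  approximable (fun x => u x * trig F c x).
Proof.
move=> Lu Au.
have Lp xi : Linf (fun x => pair x xi * u x).
  by apply: LinfM => //; exact: Linf_pair.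
have := @approximable_sum _ F (fun xi x => c xi * (pair x xi * u x))
  (fun xi => LinfZ (c xi) (Lp xi))
  (fun xi => approximableZ (c xi) (Lp xi) (approximable_mul_pair xi Au)).
apply: approximable_eq => x; rewrite /trig mulr_sumr.
by apply: eq_bigr => xi _; ring.
Qed.

(** Multiplication by the bounded [u] is continuous in [L^2], so [v] may be replaced by a
    polynomial; then the product is a combination of frequency shifts of [u]. *)
Lemma approximableM u v : Linf u -> Linf v -> approximable u -> approximable v ->
  approximable (fun x => u x * v x).
Proof.
move=> Lu Lv Au Av; apply: approximable_closed; first exact: LinfM.
move=> e e0; have [m m0 um] := nsq_mul_bounded hmu Lu.
have m1 : 0 < m + 1 by lra.
have [F [c Fc]] := Av (e / (m + 1)) (divr_gt0 e0 m1).
have Lvt : Linf (fun x => v x - trig F c x) by apply: LinfB => //; exact: Linf_trig.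
exists (fun x => u x * trig F c x); split.
- by apply: LinfM => //; exact: Linf_trig.
- exact: approximable_mul_trig.
rewrite (_ : (fun x => _) = (fun x => u x * (v x - trig F c x))); last first.
  by apply/funext => x; rewrite mulrBr.
apply: le_lt_trans (um _ Lvt) _.
move: Fc; rewrite ltr_pdivlMr // mulrDr mulr1 [_ * m]mulrC => Fc.
by apply: le_lt_trans Fc; rewrite lerDl nsq_ge0.
Qed.

(** A real algebra closed under uniformly bounded pointwise limits; a monotone class argument will
    show that it is all of [bm]. *)
Definition rapprox g := bm g /\ approximable (fun x => Complex (g x) 0).

Lemma rapprox_eq g h : (forall x, g x = h x) -> rapprox g -> rapprox h.
Proof. by move=> /funext ->. Qed.

Lemma rapprox_cst a : rapprox (fun=> a).
Proof. by split; [exact: bm_cst|exact: approximable_cst]. Qed.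

Lemma rapproxD g h : rapprox g -> rapprox h -> rapprox (fun x => g x + h x).
Proof.
move=> [bg Ag] [bh Ah]; split; first exact: bmD.
have := approximableD (Linf_real bg) (Linf_real bh) Ag Ah.
by apply: approximable_eq => x; apply: complex_eq; rewrite !reimE /= ?addr0.
Qed.

Lemma rapproxM g h : rapprox g -> rapprox h -> rapprox (fun x => g x * h x).
Proof.
move=> [bg Ag] [bh Ah]; split; first exact: bmM.
have := approximableM (Linf_real bg) (Linf_real bh) Ag Ah.
by apply: approximable_eq => x; apply: complex_eq; rewrite !reimE /=; ring.
Qed.

Lemma rapproxZ a g : rapprox g -> rapprox (fun x => a * g x).
Proof. by move=> Ag; apply: rapproxM => //; exact: rapprox_cst. Qed.

Lemma rapproxB g h : rapprox g -> rapprox h -> rapprox (fun x => g x - h x).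
Proof.
move=> Ag Ah; apply: rapprox_eq (rapproxD Ag (rapproxZ (-1) Ah)) => x.
by rewrite mulN1r.
Qed.

Lemma rapproxX g n : rapprox g -> rapprox (fun x => g x ^+ n).
Proof.
move=> Ag; elim: n => [|n IH]; first exact: rapprox_cst.
by apply: rapprox_eq (rapproxM Ag IH) => x; rewrite exprS.
Qed.

Lemma rapprox_sum (I : Type) (s : seq I) (f : I -> G -> R) :
  (forall i, rapprox (f i)) -> rapprox (fun x => \sum_(i <- s) f i x).
Proof.
move=> Af; elim: s => [|i s IH].
  by apply: rapprox_eq (rapprox_cst 0) => x; rewrite big_nil.
by apply: rapprox_eq (rapproxD (Af i) IH) => x; rewrite big_cons.
Qed.

(** Dominated convergence for [(g - gn) ^ 2], with the constant [(2 M) ^ 2] as majorant. *)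
Lemma rapprox_lim (gn : nat -> G -> R) g (M : R) :
  (forall n, rapprox (gn n)) -> (forall n x, `|gn n x| <= M) ->
  (forall x, gn ^~ x @ \oo --> g x) -> rapprox g.
Proof.
move=> Agn gnM gng.
have mg : measurable_fun setT g.
  apply: (measurable_fun_cvg (h := gn)) => //.
  by move=> n; have [[]] := Agn n.
have gM x : `|g x| <= M.
  by apply: (cvgr_to_le (cvg_norm (gng x))); apply: nearW => n; exact: gnM.
have bg : bm g by split=> //; exists M; exact: aeW.
split=> //; apply: approximable_closed; first exact: Linf_real.
pose d n x := (g x - gn n x) ^+ 2.
have bd n : bm (d n) by apply: bm_sqr; apply: bmB => //; have [] := Agn n.
have dcvg : (\int[mu]_x (d n x)%:E)%E @[n --> \oo] --> 0%E.
  have [|||||_ _] := @dominated_convergence _ _ _ mu setT measurableT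
    (fun n x => (d n x)%:E) (cst 0%E) (cst ((2 * M) ^+ 2)%:E).
  - by move=> n; apply/measurable_EFinP; have [] := bd n.
  - exact: measurable_cst.
  - apply: aeW => x _; apply: cvg_EFin; first exact: nearW.
    rewrite /comp /= /d -[X in _ --> X](mulr0 (0 : R)).
    apply: cvgM; rewrite -(subrr (g x)); apply: cvgB => //; exact: cvg_cst.
  - exact: (bm_integrable mu1 (bm_cst mu _)).
  - apply: aeW => x n _; rewrite /= lee_fin /d ger0_norm ?sqr_ge0 //.
    rewrite -[leLHS]real_normK ?num_real // lerXn2r ?nnegrE //.
      by rewrite mulr_ge0 // (le_trans _ (gM x)).
    rewrite mulr_natl mulr2n; apply: le_trans (ler_normB _ _) _.
    exact: lerD.
  by rewrite integral_cst // mul0e.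
move=> e e0.
have [N _ /(_ N (leqnn N)) /= dN] := cvgr_lt _ (fine_cvg dcvg) _ e0.
exists (fun x => Complex (gn N x) 0); split.
- by apply: Linf_real; have [] := Agn N.
- by have [] := Agn N.
- apply: le_lt_trans dN.
  rewrite le_eqVlt; apply/orP; left; apply/eqP; rewrite /normL2sq /Rintegral /=.
  congr fine; apply: eq_integral => x _; congr EFin.
  by rewrite /sqn !reimE /= subr0 expr0n addr0.
Qed.

Lemma rapprox_step g : rapprox g -> (forall x, 0 <= g x <= 1) ->
  rapprox (fun x => if g x < 2^-1 then 1 else 0).
Proof.
move=> Ag g01; apply: (@rapprox_lim (fun n x => step_poly n (g x)) _ 1).
- by move=> n; apply: rapproxX; apply: rapproxB; [exact: rapprox_cst|exact: rapproxX].
- move=> n x; have /andP[q0 q1] := step_poly_itv n (g01 x).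
  by rewrite ger0_norm.
- by move=> x; exact: cvg_step_poly.
Qed.

Definition approx_set (A : set G) := rapprox (\1_A).

Lemma rapprox_sublevel g (a : R) : rapprox g -> (forall x, `|g x| <= 1) ->
  approx_set (g @^-1` `]-oo, a[%classic).
Proof.
(* As [|g - a| <= 1 + |a|], dividing by [C] gives at most [1/2]; so the affine rescaling [s] takes
   values in [[0, 1]] and sends the level [a] to the threshold [1/2]. *)
move=> Ag g1; pose C := 2 * (1 + `|a|).
have C0 : 0 < C by rewrite mulr_gt0 // ltr_wpDr.
pose s x := 2^-1 + C^-1 * (g x - a).
have ga x : `|g x - a| <= 1 + `|a|.
  by apply: le_trans (ler_normB _ _) _; rewrite lerD2r.
have Cs x : `|C^-1 * (g x - a)| <= 2^-1.
  by rewrite normrM gtr0_norm ?invr_gt0 // mulrC ler_pdivrMr // mulKf ?pnatr_eq0.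
have As : rapprox s.
  apply: rapproxD; first exact: rapprox_cst.
  by apply: rapproxZ; apply: rapproxB => //; exact: rapprox_cst.
apply: (rapprox_eq _ (rapprox_step As _)) => x; last first.
  have := Cs x; rewrite ler_norml => /andP[h1 h2]; rewrite /s.
  by apply/andP; split; lra.
rewrite indicE /s -ltrBrDl subrr pmulr_rlt0 ?invr_gt0 // subr_lt0.
have -> : (x \in g @^-1` `]-oo, a[%classic) = (g x < a).
  by apply/idP/idP; rewrite inE /= in_itv.
by case: ltP.
Qed.

Lemma approx_setC (A : set G) : approx_set A -> approx_set (~` A).
Proof.
move=> AA; apply: rapprox_eq (rapproxB (rapprox_cst 1) AA) => x.
by rewrite !indicE in_setC; case: (x \in A); rewrite ?subrr ?subr0.
Qed.

Lemma approx_set_bigcup (A : (set G)^nat) : (forall n, approx_set (A n)) ->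
  approx_set (\bigcup_n A n).
Proof.
move=> AA.
(* The indicator of the complement of the first [n] sets: a finite product, so it stays in the
   algebra, and [1 - v n] converges pointwise to the indicator of the union. *)
pose v n x : R := \prod_(k < n) (1 - \1_(A k) x).
have v01 n x : v n x = 0 \/ v n x = 1.
  rewrite /v; elim: n => [|n IH]; first by rewrite big_ord0; right.
  rewrite big_ord_recr /=; case: IH => ->; rewrite ?mul0r; first by left.
  by rewrite mul1r indicE; case: (x \in _); rewrite ?subrr ?subr0; [left|right].
apply: (@rapprox_lim (fun n x => 1 - v n x) _ 1).
- move=> n; apply: rapproxB; first exact: rapprox_cst.
  elim: n => [|n IH].
    by apply: rapprox_eq (rapprox_cst 1) => x; rewrite /v big_ord0.
  apply: rapprox_eq (rapproxM IH (rapproxB (rapprox_cst 1) (AA n))) => x.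
  by rewrite /v big_ord_recr.
- move=> n x; case: (v01 n x) => ->; first by rewrite subr0 normr1.
  by rewrite subrr normr0.
- move=> x; rewrite indicE; have [xA|xA] := boolP (x \in _).
    move: xA; rewrite inE => -[k _ Ak].
    apply: cvg_near_cst; exists k.+1 => // n /= kn.
    by rewrite /v (bigD1 (Ordinal kn)) //= indicE mem_set // subrr mul0r subr0.
  apply: cvg_near_cst; apply: nearW => n.
  rewrite /v big1 ?subrr // => k _; rewrite indicE memNset ?subr0 // => Ak.
  by move: xA; rewrite notin_setE; apply; exists k.
Qed.

Lemma approx_set_sigma_algebra : sigma_algebra setT approx_set.
Proof.
split.
- by apply: rapprox_eq (rapprox_cst 0) => x; rewrite indic0.
- by move=> A AA; rewrite setTD; exact: approx_setC.
- exact: approx_set_bigcup.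
Qed.

Lemma approx_set_preimage g (B : set R) : rapprox g -> (forall x, `|g x| <= 1) ->
  measurable B -> approx_set (g @^-1` B).
Proof.
move=> Ag g1; rewrite [measurable B](_ : _ = <<s @RGenInftyO.G R >> B); last first.
  by rewrite -[LHS]/((ocitv (R:=R)).-sigma.-measurable B) RGenInftyO.measurableE.
apply: (smallest_sub (X := fun B => approx_set (g @^-1` B))) => //.
  split.
  - by rewrite preimage_set0; case: approx_set_sigma_algebra.
  - by move=> A AA; rewrite setTD preimage_setC; exact: approx_setC.
  - by move=> A AA; rewrite preimage_bigcup; exact: approx_set_bigcup.
by move=> _ [a ->]; exact: rapprox_sublevel.
Qed.

Lemma rapprox_re_pair xi : rapprox (fun x => re (pair x xi)).
Proof.
have /LinfP[br _] := Linf_pair mu xi; split=> //.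
have Lp eta := Linf_pair mu eta.
have := approximableZ (Complex 2^-1 0) (LinfD (Lp xi) (Lp (- xi)))
  (approximableD (Lp xi) (Lp (- xi)) (approximable_pair xi) (approximable_pair (- xi))).
apply: approximable_eq => x; rewrite pairN.
by apply: complex_eq; rewrite !reimE /=; field.
Qed.

Lemma rapprox_im_pair xi : rapprox (fun x => im (pair x xi)).
Proof.
have /LinfP[_ bi] := Linf_pair mu xi; split=> //.
have Lp eta := Linf_pair mu eta.
have Lm := LinfZ (-1) (Lp (- xi)).
have := approximableZ (Complex 0 (- 2^-1)) (LinfD (Lp xi) Lm)
  (approximableD (Lp xi) Lm (approximable_pair xi)
    (approximableZ (-1) (Lp (- xi)) (approximable_pair (- xi)))).
apply: approximable_eq => x; rewrite pairN.
by apply: complex_eq; rewrite !reimE /=; field.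
Qed.

(** The generators of the sigma-algebra are Borel preimages under real and imaginary parts of
    characters, which belong to the algebra and are bounded by [1]. *)
Lemma measurable_approx_set (A : set G) : measurable A -> approx_set A.
Proof.
apply: (smallest_sub approx_set_sigma_algebra) => _ [xi [B [mB [->|->]]]].
  apply: (@approx_set_preimage (fun x => re (pair x xi))) => //.
    exact: rapprox_re_pair.
  by move=> x; rewrite -(normc_pair x xi) re_le_normc.
apply: (@approx_set_preimage (fun x => im (pair x xi))) => //.
  exact: rapprox_im_pair.
by move=> x; rewrite -(normc_pair x xi) im_le_normc.
Qed.

End Density.

(** * From indicators to all of [L^oo] *)

Section LinfDensity.
Variables (R : realType) (X : zmodType) (P : set X) (hP : pos_cone P).
Variables (mu : {measure set (Gmeas R X) -> \bar R}) (hmu : haar mu).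
Local Notation G := (Gmeas R X).
Local Notation Linf := (Linf mu).
Local Notation approximable := (approximable mu).
Local Notation bm := (bm mu).
Local Notation rapprox := (rapprox mu).
Implicit Types (u v w : G -> R[i]) (g h : G -> R).
Let mu1 : mu setT = 1%E. Proof. by case: hmu. Qed.

Import HBSimple HBNNSimple.

Lemma rapprox_nnsfun (f : {nnsfun G >-> R}) : rapprox f.
Proof.
pose s := fset_set (range f).
have := @rapprox_sum _ _ _ hP _ hmu _ (index_enum 'I_#|` s|)
   (fun i x => s`_i * \1_(f @^-1` [set s`_i]) x).
move=> H; apply: (rapprox_eq _ (H _)) => [x|i]; first by rewrite -fimfunEord.
apply: (rapproxZ hP hmu); apply: (measurable_approx_set hP hmu).
by rewrite -[X in measurable X]setTI; apply: measurable_funP.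
Qed.

Lemma rapprox_bounded_ge0 g (M : R) : measurable_fun setT g ->
  (forall x, 0 <= g x <= M) -> rapprox g.
Proof.
move=> mg g0M.
have g0 x : 0 <= g x by have /andP[] := g0M x.
have mEg : measurable_fun setT (EFin \o g) by exact/measurable_EFinP.
pose gn n := nnsfun_approx measurableT mEg n.
have Eg0 x : setT x -> (0 <= (EFin \o g) x)%E by rewrite /= lee_fin.
apply: (rapprox_lim hmu (gn := fun n x => gn n x) (M := M)).
- by move=> n; exact: rapprox_nnsfun.
- move=> n x; rewrite ger0_norm //; have /andP[_] := g0M x; apply: le_trans.
  by rewrite -lee_fin /gn nnsfun_approxE; exact: (le_approx _ Eg0).
- move=> x; have := @cvg_nnsfun_approx _ _ _ _ measurableT _ mEg Eg0 x I.
  by move=> /fine_cvg.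
Qed.

Lemma rapprox_bm g : bm g -> rapprox g.
Proof.
move=> bg; have [M M0 gM] := bm_ge0 bg; have [mg _] := bg.
(* Clipping to [[-M, M]] alters [g] on a null set only and makes the bound hold everywhere; adding
   [M] makes the result nonnegative, as simple-function approximation requires. *)
pose w x := Num.min (Num.max (g x) (- M)) M + M.
have Aw : rapprox w.
  apply: (@rapprox_bounded_ge0 _ (M + M)).
    apply: measurable_funD; last exact: measurable_cst.
    apply: measurable_minr; last exact: measurable_cst.
    by apply: measurable_maxr => //; exact: measurable_cst.
  move=> x; rewrite lerD2r ge_min lexx orbT andbT -lerBlDr sub0r.
  by rewrite le_min le_max lexx orbT /= lerNl (le_trans _ M0) // oppr_le0.
have AwM := rapproxB hP hmu Aw (rapprox_cst hmu M).
split=> //.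
apply: (approximable_ae hmu _ _ _ (proj2 AwM)); try apply: Linf_real => //.
  by have [] := AwM.
apply: filterS gM => x; rewrite ler_norml => /andP[h1 h2].
by rewrite /w addrK max_l // min_l.
Qed.

Lemma Linf_approximable u : Linf u -> approximable u.
Proof.
move=> /LinfP[br bi].
have [[_ Ar] [_ Ai]] := (rapprox_bm br, rapprox_bm bi).
have Li := LinfZ (Complex 0 1) (Linf_real bi).
have := approximableD hP hmu (Linf_real br) Li Ar (approximableZ hmu _ (Linf_real bi) Ai).
by apply: approximable_eq => x; apply: complex_eq; rewrite !reimE /=; ring.
Qed.

End LinfDensity.

(** * Unordered sums *)

Section UnorderedSums.
Variables (R : realType) (X : zmodType).
Implicit Types (a b : X -> R[i]) (s t : R[i]) (F E : {fset X}).

Lemma has_sum_unique a s t : has_sum a s -> has_sum a t -> s = t.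
Proof.
move=> Hs Ht; apply/eqP; rewrite -subr_eq0; apply/eqP; apply: Normc.eq0_normc.
apply/eqP; rewrite eq_le normc_ge0 andbT; apply/ler_addgt0Pl => e e0.
have e2 : 0 < e / 2 by lra.
have [F1 H1] := Hs _ e2; have [F2 H2] := Ht _ e2.
have h1 := H1 _ (fsubsetUl F1 F2); have h2 := H2 _ (fsubsetUr F1 F2).
rewrite addr0 [s - t](_ : _ = - (\sum_(xi <- (F1 `|` F2)%fset) a xi - s) +
  (\sum_(xi <- (F1 `|` F2)%fset) a xi - t)); last by ring.
apply: le_trans (le_normcD _ _) _; rewrite normcN.
by rewrite [e]splitr ltW // ltrD.
Qed.

Lemma has_sumD a b s t : has_sum a s -> has_sum b t ->
  has_sum (fun xi => a xi + b xi) (s + t).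
Proof.
move=> Hs Ht e e0; have e2 : 0 < e / 2 by lra.
have [F1 H1] := Hs _ e2; have [F2 H2] := Ht _ e2.
exists (F1 `|` F2)%fset => F; rewrite fsubUset => /andP[/H1 h1 /H2 h2].
rewrite big_split /= opprD addrACA.
apply: le_lt_trans (le_normcD _ _) _.
by rewrite [e]splitr ltrD.
Qed.

Lemma has_sumZ c a s : has_sum a s -> has_sum (fun xi => c * a xi) (c * s).
Proof.
move=> Hs e e0.
have c0 : 0 < normc c + 1 by have := normc_ge0 c; lra.
have [F0 H] := Hs _ (divr_gt0 e0 c0); exists F0 => F /H.
rewrite ltr_pdivlMr // mulrDr mulr1 => h.
rewrite -mulr_sumr -mulrBr Normc.normcM mulrC; apply: le_lt_trans h.
by rewrite lerDl normc_ge0.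
Qed.

Lemma has_sumB a b s t : has_sum a s -> has_sum b t ->
  has_sum (fun xi => a xi - b xi) (s - t).
Proof.
move=> Ha /(has_sumZ (-1)) Hb; have := has_sumD Ha Hb; rewrite mulN1r.
by under eq_fun do rewrite mulN1r.
Qed.

Lemma has_sum_fin a F : (forall xi, xi \notin F -> a xi = 0) ->
  has_sum a (\sum_(xi <- F) a xi).
Proof.
move=> a0 e e0; exists F => F' FF'.
rewrite (big_fset_incl _ FF') => [|xi _ /a0 //].
by rewrite subrr Normc.normc0.
Qed.

Lemma has_sum_eq a b s : (forall xi, a xi = b xi) -> has_sum a s -> has_sum b s.
Proof. by move=> /funext ->. Qed.

Lemma has_sum_sum (I : Type) (l : seq I) (f : I -> X -> R[i]) (s : I -> R[i]) :
  (forall i, has_sum (f i) (s i)) ->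
  has_sum (fun xi => \sum_(i <- l) f i xi) (\sum_(i <- l) s i).
Proof.
move=> H; elim: l => [|i l IH].
  rewrite big_nil; have := @has_sum_fin (fun=> 0) fset0 (fun _ _ => erefl).
  by rewrite big_seq_fset0; apply: has_sum_eq => xi; rewrite big_nil.
rewrite big_cons; apply: has_sum_eq (has_sumD (H i) IH) => xi.
by rewrite big_cons.
Qed.

Lemma has_sum_sqn_le a s (B : R) : (forall F, sqn (\sum_(xi <- F) a xi) <= B) ->
  has_sum a s -> sqn s <= B.
Proof.
move=> aB Hs.
have B0 : 0 <= B := le_trans (sqn_ge0 _) (aB fset0).
rewrite -[B]sqr_sqrtr // -normc_le_sqn ?sqrtr_ge0 //.
apply/ler_addgt0Pl => e e0; have [F0 /(_ F0 (fsubset_refl _)) H] := Hs e e0.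
have := aB F0; rewrite -[X in _ <= X]sqr_sqrtr // -normc_le_sqn ?sqrtr_ge0 // => h.
rewrite [s](_ : _ = - (\sum_(xi <- F0) a xi - s) + \sum_(xi <- F0) a xi); last by ring.
apply: le_trans (le_normcD _ _) _; rewrite normcN.
by apply: lerD => //; exact: ltW.
Qed.

Lemma sum_fset_sup (a : X -> R) (M : R) : (forall xi, 0 <= a xi) ->
  (forall F, \sum_(xi <- F) a xi <= M) -> exists s : R,
  (forall F, \sum_(xi <- F) a xi <= s) /\
  forall e, 0 < e -> exists F0, forall F, (F0 `<=` F)%fset ->
    s - e < \sum_(xi <- F) a xi.
Proof.
move=> a0 aM; pose S := [set r | exists F, r = \sum_(xi <- F) a xi].
have hS : has_sup S.
  split; first by exists (\sum_(xi <- fset0) a xi), fset0.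
  by exists M => _ [F ->].
exists (sup S); split.
  by move=> F; apply: sup_upper_bound => //; exists F.
move=> e e0; have [_ [F0 ->] h] := sup_adherent e0 hS.
exists F0 => F F0F; apply: lt_le_trans h _.
exact: sumr_fsubset_le.
Qed.

Lemma real_summable (a : X -> R) (M : R) :
  (forall F, \sum_(xi <- F) `|a xi| <= M) -> exists s : R,
  forall e, 0 < e -> exists F0, forall F, (F0 `<=` F)%fset ->
    `|\sum_(xi <- F) a xi - s| < e.
Proof.
move=> aM.
have [s1 [s1u H1]] := sum_fset_sup (fun xi => normr_ge0 (a xi)) aM.
(* The family is written as [(|a| + a) - |a|], a difference of two nonnegative families with bounded
   partial sums. *)
have a0 xi : 0 <= `|a xi| + a xi by have := ler_norm (- a xi); rewrite normrN; lra.
have aM2 F : \sum_(xi <- F) (`|a xi| + a xi) <= M + M.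
  rewrite big_split /= lerD //; apply: le_trans (aM F).
  by apply: ler_sum => xi _; exact: ler_norm.
have [s2 [s2u H2]] := sum_fset_sup a0 aM2.
exists (s2 - s1) => e e0.
have [F1 h1] := H1 e e0; have [F2 h2] := H2 e e0.
exists (F1 `|` F2)%fset => F; rewrite fsubUset => /andP[/h1 {}h1 /h2 {}h2].
have := s1u F; have := s2u F; move: h1 h2; rewrite big_split /=.
move: (\sum_(xi <- F) `|a xi|) (\sum_(xi <- F) a xi) => p q h1 h2 h3 h4.
by rewrite ltr_norml; apply/andP; split; lra.
Qed.

Lemma complex_summable a (M : R) : (forall F, \sum_(xi <- F) normc (a xi) <= M) ->
  exists s, has_sum a s.
Proof.
move=> aM.
have [r Hr] : exists r : R, forall e, 0 < e -> exists F0, forall F,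
    (F0 `<=` F)%fset -> `|\sum_(xi <- F) re (a xi) - r| < e.
  apply: (@real_summable _ M) => F; apply: le_trans (aM F).
  by apply: ler_sum => xi _; exact: re_le_normc.
have [i Hi] : exists r : R, forall e, 0 < e -> exists F0, forall F,
    (F0 `<=` F)%fset -> `|\sum_(xi <- F) im (a xi) - r| < e.
  apply: (@real_summable _ M) => F; apply: le_trans (aM F).
  by apply: ler_sum => xi _; exact: im_le_normc.
exists (Complex r i) => e e0; have e2 : 0 < e / 2 by lra.
have [F1 H1] := Hr _ e2; have [F2 H2] := Hi _ e2.
exists (F1 `|` F2)%fset => F; rewrite fsubUset => /andP[/H1 h1 /H2 h2].
apply: le_lt_trans (normc_le_reim _) _; rewrite !reimE /= re_sum im_sum.
by rewrite [e]splitr ltrD.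
Qed.

Lemma l2_mul_summable a b (A B : R) : (forall F, \sum_(xi <- F) sqn (a xi) <= A) ->
  (forall F, \sum_(xi <- F) sqn (b xi) <= B) ->
  exists2 s, has_sum (fun xi => a xi * b xi) s & sqn s <= A * B.
Proof.
move=> aA bB.
have [s Hs] : exists s, has_sum (fun xi => a xi * b xi) s.
  apply: (@complex_summable _ (A + B)) => F.
  apply: (@le_trans _ _ (\sum_(xi <- F) (sqn (a xi) + sqn (b xi)))).
    apply: ler_sum => xi _; rewrite Normc.normcM -!normc2.
    move: (normc_ge0 (a xi)) (normc_ge0 (b xi)).
    by move: (normc (a xi)) (normc (b xi)) => p q p0 q0; nra.
  by rewrite big_split lerD.
exists s => //; apply: has_sum_sqn_le Hs => F.
apply: le_trans (sum_CauchySchwarz _ _ _) _.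
by apply: ler_pM => //; apply: sumr_ge0 => xi _; exact: sqn_ge0.
Qed.

Definition truncate F (g : X -> R[i]) xi := if xi \in F then g xi else 0.

(** The estimate is uniform in [E]: enlarging [E] by [F], the tail becomes the sum over the union
    minus the sum over [F], and the latter is close to the supremum of all partial sums. *)
Lemma l2_tail (g : X -> R[i]) (B : R) : (forall F, \sum_(xi <- F) sqn (g xi) <= B) ->
  forall e : R, 0 < e -> exists F0, forall F E, (F0 `<=` F)%fset ->
    \sum_(xi <- E) sqn (g xi - truncate F g xi) <= e.
Proof.
move=> gB e e0; have [s [su H]] := sum_fset_sup (fun xi => sqn_ge0 (g xi)) gB.
have [F0 h] := H e e0; exists F0 => F E /h {}h.
apply: (@le_trans _ _ (\sum_(xi <- (E `|` F)%fset) sqn (g xi - truncate F g xi))).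
  by apply: sumr_fsubset_le; [move=> xi; exact: sqn_ge0|exact: fsubsetUl].
have -> : \sum_(xi <- (E `|` F)%fset) sqn (g xi - truncate F g xi) =
   \sum_(xi <- (E `|` F)%fset) sqn (g xi) -
   \sum_(xi <- (E `|` F)%fset) (if xi \in F then sqn (g xi) else 0).
  rewrite -sumrB; apply: eq_bigr => xi _; rewrite /truncate.
  by case: ifP => _; rewrite ?subrr ?sqn0 ?subr0.
have -> : \sum_(xi <- (E `|` F)%fset) (if xi \in F then sqn (g xi) else 0) =
    \sum_(xi <- F) sqn (g xi).
  transitivity (\sum_(xi <- F) (if xi \in F then sqn (g xi) else 0)).
    apply/esym; apply: big_fset_incl; first exact: fsubsetUr.
    by move=> xi _ /negbTE ->.
  by rewrite big_seq [RHS]big_seq; apply: eq_bigr => xi ->.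
by have := su (E `|` F)%fset; lra.
Qed.

Lemma is_l2P (g : X -> R[i]) : is_l2 g <->
  exists B : R, forall F, \sum_(xi <- F) sqn (g xi) <= B.
Proof.
split=> -[B H]; exists B => F; have := H F.
  by under eq_bigr do rewrite normc2.
by under [X in _ -> X <= _]eq_bigr do rewrite normc2.
Qed.

End UnorderedSums.

(** * Convolution with a Fourier transform *)

Section Convolution.
Variables (R : realType) (X : zmodType) (P : set X) (hP : pos_cone P).
Variables (mu : {measure set (Gmeas R X) -> \bar R}) (hmu : haar mu).
Local Notation G := (Gmeas R X).
Local Notation Linf := (Linf mu).
Local Notation hat := (fourier mu).
Local Notation nsq := (normL2sq mu).
Implicit Types (u v w : G -> R[i]) (g s : X -> R[i]) (F E : {fset X}).
Let mu1 : mu setT = 1%E. Proof. by case: hmu. Qed.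

(** Convolution on all of [X], with no projection onto the cone; a relation, like [Wrel], because it
    includes the convergence of every series. *)
Definition hconv u g s := forall xi,
  has_sum (fun eta => hat u (xi - eta) * g eta) (s xi).

Lemma hconv_ext u g s t : hconv u g s -> hconv u g t -> s = t.
Proof. by move=> gs gt; apply/funext => xi; exact: has_sum_unique (gs xi) (gt xi). Qed.

Lemma sum_hat_reflect_le u xi F : Linf u ->
  \sum_(eta <- F) sqn (hat u (xi - eta)) <= nsq u.
Proof.
move=> Lu; apply: le_trans (Bessel hP hmu [fset (xi - eta)%R | eta in F]%fset Lu).
rewrite big_imfset //= => a b _ _ /addrI /eqP.
by rewrite eqr_opp => /eqP.
Qed.

Lemma hconv_exists u g (B : R) : Linf u ->
  (forall F, \sum_(xi <- F) sqn (g xi) <= B) -> exists s, hconv u g s.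
Proof.
move=> Lu gB.
have H xi : exists s : R[i], has_sum (fun eta => hat u (xi - eta) * g eta) s.
  have [s Hs _] := l2_mul_summable (fun F => sum_hat_reflect_le xi F Lu) gB.
  by exists s.
by have [s Hs] := choice H; exists s.
Qed.

Lemma hconv_pointwise_le u g s (B : R) xi : Linf u ->
  (forall F, \sum_(xi <- F) sqn (g xi) <= B) -> hconv u g s ->
  sqn (s xi) <= nsq u * B.
Proof.
move=> Lu gB gs.
have [t Ht tB] := l2_mul_summable (fun F => sum_hat_reflect_le xi F Lu) gB.
by rewrite (has_sum_unique (gs xi) Ht).
Qed.

Lemma hconvB u g h s t : hconv u g s -> hconv u h t ->
  hconv u (fun xi => g xi - h xi) (fun xi => s xi - t xi).
Proof.
move=> gs ht xi; apply: has_sum_eq (has_sumB (gs xi) (ht xi)) => eta.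
by rewrite mulrBr.
Qed.

(* Parseval's identity for the pair [v], [x |-> conjc (u x) * pair x xi]. *)
Lemma hconv_hat u v : Linf u -> Linf v -> hconv u (hat v) (hat (fun x => u x * v x)).
Proof.
move=> Lu Lv xi e e0; have LuJ := LinfJ Lu.
have Lw : Linf (fun x => conjc (u x) * pair x xi).
  by apply: LinfM => //; exact: Linf_pair.
set w := fun x => _ in Lw.
have hatE z : hat (fun x => u x * z x) xi = ip mu z w.
  by congr cint; apply/funext => x; rewrite /w rmorphM /= conjcK; ring.
have hatw eta : conjc (hat w eta) = hat u (xi - eta).
  rewrite -(cintJ mu1); last by apply: LinfM => //; apply: LinfJ; exact: Linf_pair.
  congr cint; apply/funext => x; rewrite /w pairB !rmorphM /= !conjcK.
  by ring.
have b0 : 0 < nsq w + 1 by have := nsq_ge0 mu w; lra.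
have d0 : 0 < e ^+ 2 / (nsq w + 1) by rewrite divr_gt0 // exprn_gt0.
have [F0 H] := (approximableP hP hmu Lv).1 (Linf_approximable hP hmu Lv) _ d0.
exists F0 => F /H h; rewrite normc_lt_sqn; last exact: ltW.
have Lt := Linf_trig mu F (hat v).
have -> : \sum_(eta <- F) hat u (xi - eta) * hat v eta = ip mu (trig F (hat v)) w.
  rewrite (ipC hmu Lw Lt) (ip_trigr hmu _ _ Lw) conjc_sum; apply: eq_bigr => eta _.
  by rewrite conjcM conjcK hatw mulrC.
rewrite hatE -(sqnN (_ - _)) opprB -(ipBl hmu) //.
apply: le_lt_trans (ip_CauchySchwarz hmu (LinfB Lv Lt) Lw) _.
move: h; rewrite ltr_pdivlMr // mulrDr mulr1; apply: le_lt_trans.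
by rewrite lerDl nsq_ge0.
Qed.

Lemma hat_trigE F g xi : hat (trig F g) xi = truncate F g xi.
Proof. by rewrite /truncate (hat_trig hP hmu). Qed.

Lemma nsq_trig_le g (B : R) F :
  (forall E, \sum_(xi <- E) sqn (g xi) <= B) ->
  nsq (trig F g) <= B.
Proof. by move=> gB; rewrite (nsq_trig hP hmu). Qed.

Lemma hconv_truncate u g F : Linf u ->
  hconv u (truncate F g) (hat (fun x => u x * trig F g x)).
Proof.
move=> Lu; have := hconv_hat Lu (Linf_trig mu F g).
by rewrite (_ : hat (trig F g) = truncate F g) //; apply/funext => xi; exact: hat_trigE.
Qed.

Lemma hat_mul_trig u g F xi : Linf u ->
  hat (fun x => u x * trig F g x) xi = \sum_(eta <- F) hat u (xi - eta) * g eta.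
Proof.
move=> Lu; apply: has_sum_unique (hconv_truncate g F Lu xi) _.
rewrite [X in has_sum _ X](_ : _ =
  \sum_(eta <- F) hat u (xi - eta) * truncate F g eta); last first.
  by rewrite big_seq [RHS]big_seq; apply: eq_bigr => eta; rewrite /truncate => ->.
by apply: has_sum_fin => eta; rewrite /truncate => /negbTE ->; rewrite mulr0.
Qed.

(** Duality: [s] is paired with itself over [E]. The pairing [S] is a limit of pairings with
    coefficients of [u] times a polynomial, which Cauchy-Schwarz and Bessel bound; this gives
    [S ^ 2 <= S * (m * B)], and [S] cancels. *)
Lemma hconv_le u g s (m B : R) : Linf u -> 0 <= m ->
  (forall v, Linf v -> nsq (fun x => u x * v x) <= m * nsq v) ->
  (forall F, \sum_(xi <- F) sqn (g xi) <= B) -> hconv u g s ->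
  forall E, \sum_(xi <- E) sqn (s xi) <= m * B.
Proof.
move=> Lu m0 um gB gs E.
have B0 : 0 <= B by have := gB fset0; rewrite big_seq_fset0.
set S := \sum_(xi <- E) _.
have S0 : 0 <= S by apply: sumr_ge0 => xi _; exact: sqn_ge0.
have := has_sum_sum E (fun xi => has_sumZ (conjc (s xi)) (gs xi)).
have -> : \sum_(xi <- E) conjc (s xi) * s xi = Complex S 0.
  apply: complex_eq => /=.
    by rewrite re_sum; apply: eq_bigr => xi _; rewrite mulrC reMJ.
  by rewrite im_sum big1 // => xi _; rewrite mulrC imMJ.
move=> HS; have SS : sqn (Complex S 0) <= S * (m * B).
  apply: has_sum_sqn_le HS => F.
  rewrite exchange_big /=.
  rewrite (eq_bigr (fun xi => conjc (s xi) * hat (fun x => u x * trig F g x) xi));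
    last by move=> xi _; rewrite hat_mul_trig // mulr_sumr.
  apply: le_trans (sum_CauchySchwarz _ _ _) _.
  apply: ler_pM => //; try by apply: sumr_ge0 => xi _; exact: sqn_ge0.
    by rewrite le_eqVlt (eq_bigr (fun xi => sqn (s xi))) ?eqxx // => xi _; rewrite sqnJ.
  have Lt := Linf_trig mu F g.
  apply: le_trans (Bessel hP hmu E (LinfM Lu Lt)) _.
  apply: le_trans (um _ Lt) _; rewrite ler_wpM2l //.
  exact: nsq_trig_le.
have [->|Sn0] := eqVneq S 0; first by rewrite mulr_ge0.
have {}S0 : 0 < S by rewrite lt_def Sn0.
by move: SS; rewrite /sqn /= expr0n addr0 expr2 ler_pM2l.
Qed.

Lemma hconv_l2 u g s : Linf u -> is_l2 g -> hconv u g s -> is_l2 s.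
Proof.
move=> Lu /is_l2P[B gB] gs; have [m m0 um] := nsq_mul_bounded hmu Lu.
by apply/is_l2P; exists (m * B); exact: hconv_le um gB gs.
Qed.

(** For a truncation of [g] the claim is [w * (u * p) = p] almost everywhere for a polynomial [p].
    The general case follows because the error at a point is at most [nsq w * m] times the squared
    norm of the tail of [g]. *)
Lemma hconv_inverse u w g s : Linf u -> Linf w ->
  {ae mu, forall x, u x * w x = 1} -> is_l2 g -> hconv u g s -> hconv w s g.
Proof.
move=> Lu Lw uw /is_l2P[B gB] gs.
have [m m0 um] := nsq_mul_bounded hmu Lu.
have sB := hconv_le Lu m0 um gB gs.
have [t wt] := hconv_exists Lw sB.
suff -> : g = t by [].
apply/funext => xi; apply/eqP; rewrite eq_sym -subr_eq0; apply/eqP; apply: sqn_eq0.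
apply/eqP; rewrite eq_le sqn_ge0 andbT; apply/ler_addgt0Pl => e e0; rewrite addr0.
have c0 : 0 < nsq w * m + 1 by rewrite ltr_wpDl // mulr_ge0 // nsq_ge0.
have [F0 HF0] := l2_tail gB (divr_gt0 e0 c0).
(* Including [xi] makes the truncation agree with [g] at [xi], so the bounded error is exactly
   [t xi - g xi]. *)
pose F := (F0 `|` [fset xi])%fset.
have gF E : \sum_(eta <- E) sqn (g eta - truncate F g eta) <= e / (nsq w * m + 1).
  by apply: HF0; exact: fsubsetUl.
have Lt := Linf_trig mu F g.
have gFs := hconvB gs (hconv_truncate g F Lu).
have wF : hconv w (hat (fun x => u x * trig F g x)) (truncate F g).
  rewrite (_ : truncate F g = hat (fun x => w x * (u x * trig F g x))).
    by apply: hconv_hat => //; exact: LinfM.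
  apply/funext => eta; rewrite -hat_trigE; apply: hat_ae => //.
    by apply: LinfM => //; exact: LinfM.
  by apply: filterS uw => x ux; rewrite mulrA [w x * _]mulrC ux mul1r.
have := hconv_pointwise_le xi Lw (hconv_le Lu m0 um gF gFs) (hconvB wt wF).
have xF : xi \in F by rewrite !inE eqxx orbT.
rewrite {1}/truncate xF => /le_trans; apply.
rewrite mulrA mulrA ler_pdivrMr // mulrC.
by rewrite ler_wpM2l ?(ltW e0) // lerDl ler01.
Qed.

End Convolution.

(** * Invertibility of multiplication by a function in H^oo *)

Section PositiveCone.
Variables (X : zmodType) (P : set X) (hP : pos_cone P).

(** Totality of the order is what allows this. When [eta] fails for the new element [x], the shift
    [- x] works: it exceeds [eta] by [- (eta + x)], which is in the cone. *)
Lemma pos_cone_shift (s : seq X) : exists eta, forall xi, xi \in s -> P (eta + xi).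
Proof.
case: (hP) => P0 PD PN Ptot.
elim: s => [|x s [eta H]]; first by exists 0.
have [Px|Px] := Ptot (eta + x).
  by exists eta => xi; rewrite inE => /predU1P[->|/H].
exists (- x) => xi; rewrite inE => /predU1P[->|/H Pxi]; first by rewrite addNr.
rewrite [- x + xi](_ : _ = (eta + xi) + - (eta + x)); first exact: PD.
by rewrite opprD addrACA subrr add0r addrC.
Qed.

Lemma pos_cone_subN xi eta : P eta -> ~ P xi -> ~ P (xi - eta).
Proof.
case: hP => _ PD _ _ Pe nPx Pd; apply: nPx.
by rewrite -(subrK eta xi); exact: PD.
Qed.

End PositiveCone.

Section Wiener.
Variables (R : realType) (X : zmodType) (P : set X) (hP : pos_cone P).
Variables (mu : {measure set (Gmeas R X) -> \bar R}) (hmu : haar mu).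
Local Notation G := (Gmeas R X).
Local Notation Linf := (Linf mu).
Local Notation hat := (fourier mu).
Local Notation nsq := (normL2sq mu).
Local Notation hconv := (hconv mu).
Implicit Types (u v w : G -> R[i]) (g s : X -> R[i]) (F E : {fset X}).
Let mu1 : mu setT = 1%E. Proof. by case: hmu. Qed.

Lemma hconv_Wrel u g s : Hinf P mu u -> (forall xi, ~ P xi -> g xi = 0) ->
  Wrel P (hat u) g s <-> hconv u g s.
Proof.
move=> [Lu u0] g0.
(* Off the cone every term vanishes: either [eta] is outside it and [g eta = 0], or [xi - eta] is
   outside it and the coefficient of [u] is [0]. *)
have out xi : ~ P xi -> has_sum (fun eta => hat u (xi - eta) * g eta) 0.
  move=> nPx.
  have := @has_sum_fin R X (fun eta => hat u (xi - eta) * g eta) fset0.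
  rewrite big_seq_fset0; apply => eta _.
  have [Pe|nPe] := pselect (P eta); last by rewrite g0 // mulr0.
  by rewrite u0 ?mul0r //; exact: pos_cone_subN.
split=> [W xi|C xi].
  have [Px|nPx] := pselect (P xi); first exact: (W xi).1.
  by rewrite (W xi).2 //; exact: out.
split=> [_|nPx]; first exact: C.
exact: has_sum_unique (C xi) (out _ nPx).
Qed.

Lemma is_l2p_hat u : Hinf P mu u -> is_l2p P (hat u).
Proof.
move=> [Lu u0]; split=> //; apply/is_l2P; exists (nsq u) => F.
exact (Bessel hP hmu F Lu).
Qed.

Lemma hat_one xi : hat (fun=> 1) xi = (xi == 0)%:R.
Proof.
by rewrite -(hat_pair hP hmu); congr cint; apply/funext => x; rewrite pair0.
Qed.

Lemma Hinf_one : Hinf P mu (fun=> 1).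
Proof.
split; first exact: Linf_cst.
by move=> xi; rewrite hat_one; case: eqVneq => // -> []; case: hP.
Qed.

Lemma HinfM_trig u F c : Hinf P mu u -> (forall xi, xi \in F -> P xi) ->
  Hinf P mu (fun x => u x * trig F c x).
Proof.
move=> Hu FP; have [Lu u0] := Hu; split.
  by apply: LinfM => //; exact: Linf_trig.
have c0 xi : ~ P xi -> truncate F c xi = 0.
  by rewrite /truncate; case: ifP => // /FP.
have /(hconv_Wrel _ Hu c0) W := hconv_truncate hP hmu c F Lu.
by move=> xi nPx; rewrite (W xi).2.
Qed.

Lemma Hinf_invertible_op u : Hinf P mu u -> Hinf_invertible P mu u ->
  op_invertible P (Wrel P (hat u)).
Proof.
move=> Hu [h Hh uh]; have [Lu _] := Hu; have [Lh _] := Hh.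
have hu : {ae mu, forall x, h x * u x = 1}.
  by apply: filterS uh => x; rewrite mulrC.
split=> [t [t2 tP]|].
  have /is_l2P[B tB] := t2.
  have [g hg] := hconv_exists hP hmu Lh tB.
  have g2 := hconv_l2 hP hmu Lh t2 hg.
  have gP xi : ~ P xi -> g xi = 0 by have /(hconv_Wrel _ Hh tP) W := hg; exact: (W xi).2.
  exists g; split=> //.
    by apply/hconv_Wrel => //; exact: (hconv_inverse hP hmu Lh Lu hu t2 hg).
  move=> g' [g'2 g'P] /(hconv_Wrel _ Hu g'P) ug'.
  exact: hconv_ext (hconv_inverse hP hmu Lu Lh uh g'2 ug') hg.
have [m m0 hm] := nsq_mul_bounded hmu Lh.
exists m => g t [g2 gP] [t2 tP] /(hconv_Wrel _ Hu gP) ug M tM F.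
have hg := hconv_inverse hP hmu Lu Lh uh g2 ug.
have := hconv_le hP hmu Lh m0 hm _ hg F.
move=> /(_ M); rewrite (eq_bigr _ (fun xi _ => normc2 (g xi))); apply => E.
by have := tM E; rewrite (eq_bigr _ (fun xi _ => normc2 (t xi))).
Qed.

Lemma op_invertible_trig_le u : Hinf P mu u -> op_invertible P (Wrel P (hat u)) ->
  exists2 C : R, 0 <= C & forall F c,
    nsq (trig F c) <= C * nsq (fun x => u x * trig F c x).
Proof.
move=> Hu [_ [C hC]]; have [Lu _] := Hu.
(* The constant of [op_invertible] may have any sign, whereas later estimates multiply inequalities
   by it. *)
exists `|C| => // F c.
have [eta FP] := pos_cone_shift hP F.
set F' := [fset (eta + xi)%R | xi in F]%fset.
set c' := fun xi => c (xi - eta).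
have F'P xi : xi \in F' -> P xi by move=> /imfsetP[x /= xF ->]; exact: FP.
have pE : trig F' c' = (fun x : G => pair x eta * trig F c x).
  by apply/funext => x; exact: trig_shift.
rewrite -(nsq_mul_pair mu (trig F c) eta) -pE.
rewrite -(nsq_mul_pair mu (fun x => u x * trig F c x) eta).
rewrite (_ : (fun x => pair x eta * _) = (fun x => u x * trig F' c' x)); last first.
  by apply/funext => x; rewrite pE mulrCA.
have Lp := Linf_trig mu F' c'.
have c'0 xi : ~ P xi -> truncate F' c' xi = 0.
  by rewrite /truncate; case: ifP => // /F'P.
have W : Wrel P (hat u) (truncate F' c') (hat (fun x => u x * trig F' c' x)).
  by apply/hconv_Wrel => //; exact: (hconv_truncate hP hmu c' F' Lu).
have c'l2 : is_l2p P (truncate F' c').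
  split=> //; apply/is_l2P; exists (nsq (trig F' c')) => E.
  rewrite (eq_bigr (fun xi => sqn (hat (trig F' c') xi))); first exact (Bessel hP hmu E Lp).
  by move=> xi _; rewrite (hat_trigE hP hmu).
have := hC _ _ c'l2 (is_l2p_hat (HinfM_trig c' Hu F'P)) W.
move=> /(_ (nsq (fun x => u x * trig F' c' x)) _ F') H.
rewrite {1}(nsq_trig hP hmu).
apply: (@le_trans _ _ (C * nsq (fun x => u x * trig F' c' x))); last first.
  by rewrite ler_wpM2r ?nsq_ge0 // ler_norm.
rewrite (_ : \sum_(xi <- F') sqn (c' xi) =
    \sum_(xi <- F') normc (truncate F' c' xi) ^+ 2).
  apply: H => E; rewrite (eq_bigr _ (fun xi _ => normc2 _)).
  exact (Bessel hP hmu E (LinfM Lu Lp)).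
by rewrite big_seq [RHS]big_seq; apply: eq_bigr => xi; rewrite normc2 /truncate => ->.
Qed.

Lemma op_invertible_nsq_le u : Hinf P mu u -> op_invertible P (Wrel P (hat u)) ->
  exists2 C : R, 0 <= C & forall v, Linf v ->
    nsq v <= C * nsq (fun x => u x * v x).
Proof.
move=> Hu /(op_invertible_trig_le Hu)[C C0 HC]; have [Lu _] := Hu.
(* The factor [4] comes from splitting twice with [nsqD_le]. If [q] is the squared distance from [v]
   to the polynomial, the total error is [q * (2 + 4 * C * m)], whence the tolerance chosen
   below. *)
exists (4 * C) => [|v Lv]; first by rewrite mulr_ge0.
have [m m0 um] := nsq_mul_bounded hmu Lu.
apply/ler_addgt0Pl => e e0.
have b0 : 0 < 2 + 4 * C * m by rewrite ltr_wpDr // mulr_ge0 // mulr_ge0.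
have [F [c Fc]] := Linf_approximable hP hmu Lv (divr_gt0 e0 b0).
have Lt := Linf_trig mu F c.
have Lvt := LinfB Lv Lt.
have h1 : nsq v <= 2 * nsq (fun x => v x - trig F c x) + 2 * nsq (trig F c).
  rewrite {1}(_ : v = (fun x => (v x - trig F c x) + trig F c x)).
    exact: nsqD_le.
  by apply/funext => x; rewrite subrK.
have h2 : nsq (fun x => u x * trig F c x) <= 2 * nsq (fun x => u x * v x) +
    2 * nsq (fun x => - u x * (v x - trig F c x)).
  rewrite {1}(_ : (fun x => u x * trig F c x) =
     (fun x => u x * v x + - u x * (v x - trig F c x))).
    by apply: nsqD_le => //; apply: LinfM => //; exact: LinfN.
  by apply/funext => x; ring.
have h3 : nsq (fun x => - u x * (v x - trig F c x)) <=
    m * nsq (fun x => v x - trig F c x).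
  rewrite (_ : nsq (fun x => - u x * _) = nsq (fun x => u x * (v x - trig F c x))).
    exact: um.
  by congr (Rintegral _ _ _); apply/funext => x; rewrite mulNr sqnN.
have h4 := HC F c.
move: Fc; rewrite ltr_pdivlMr // => Fc.
move: (nsq (fun x => - u x * _)) (nsq (fun x => u x * trig F c x)) (nsq (trig F c))
  (nsq (fun x => v x - _)) (nsq (fun x => u x * v x)) (nsq v) Fc h1 h2 h3 h4.
move=> a b p q r t Fc h1 h2 h3 h4.
have h5 : C * a <= C * (m * q) by rewrite ler_wpM2l.
have h6 : C * b <= C * (2 * r + 2 * a) by rewrite ler_wpM2l.
have h7 : q * (2 + 4 * C * m) = 2 * q + 4 * (C * (m * q)) by ring.
have h8 : C * (2 * r + 2 * a) = 2 * (C * r) + 2 * (C * a) by ring.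
have h9 : 4 * C * r = 4 * (C * r) by ring.
by rewrite h9; lra.
Qed.

End Wiener.

(** * Reciprocals in [H^oo], the symbol of [k], and the spectral parameter *)

Section WienerConverse.
Variables (R : realType) (X : zmodType) (P : set X) (hP : pos_cone P).
Variables (mu : {measure set (Gmeas R X) -> \bar R}) (hmu : haar mu).
Local Notation G := (Gmeas R X).
Local Notation Linf := (Linf mu).
Local Notation hat := (fourier mu).
Local Notation nsq := (normL2sq mu).
Implicit Types (u v w : G -> R[i]) (g s : X -> R[i]) (F E : {fset X}).
Let mu1 : mu setT = 1%E. Proof. by case: hmu. Qed.

(* Test the lower bound on the indicator of the set where [sqn u] is small. *)
Lemma nsq_le_bounded_below u (C : R) : Linf u -> 0 <= C ->
  (forall v, Linf v -> nsq v <= C * nsq (fun x => u x * v x)) ->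
  exists2 c : R, 0 < c & {ae mu, forall x, c <= sqn (u x)}.
Proof.
(* Chosen so that [C * c <= 1/2]: the indicator [v] of the set [sqn u < c] then satisfies
   [nsq v <= nsq v / 2], so that set is null. *)
move=> Lu C0 HC; pose c := (2 * (C + 1))^-1.
have c0 : 0 < c by rewrite invr_gt0 mulr_gt0 // ltr_wpDl.
exists c => //.
have [ms _] := bm_sqn Lu.
pose A : set G := (fun x => sqn (u x)) @^-1` `]-oo, c[%classic.
have mA : measurable A by rewrite -[A]setTI; exact: ms.
have bA : bm mu (\1_A : G -> R).
  split; first exact: measurable_indic.
  by exists 1; apply: aeW => x; rewrite indicE; case: (x \in A); rewrite ?normr1 ?normr0.
pose v : G -> R[i] := fun x => Complex (\1_A x) 0.
have Lv : Linf v by exact: Linf_real.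
have uv : nsq (fun x => u x * v x) <= c * nsq v.
  rewrite -(rintZ mu1); last exact: bm_sqn.
  apply: (rint_le mu1); [exact: bm_sqn (LinfM Lu Lv)|exact: bmZ (bm_sqn Lv)|].
  apply: aeW => x; rewrite sqnM /v indicE.
  have [|_] := boolP (x \in A); last by rewrite /sqn /= expr0n addr0 !mulr0.
  rewrite inE /A /= in_itv /= => xA.
  by rewrite ler_wpM2r ?sqn_ge0 // ltW.
have v0 : nsq v = 0.
  apply/eqP; rewrite eq_le nsq_ge0 andbT.
  have h : nsq v <= C * (c * nsq v).
    by apply: le_trans (HC _ Lv) _; rewrite ler_wpM2l.
  have Cc : C * c <= 2^-1.
    rewrite /c invfM mulrCA ler_piMr ?invr_ge0 //.
    by rewrite ler_pdivrMr ?mul1r ?lerDl // ltr_wpDl.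
  have h' : C * c * nsq v <= 2^-1 * nsq v by rewrite ler_wpM2r ?nsq_ge0.
  by move: h h'; rewrite mulrA; lra.
exists A; split=> //; last by move=> x /= /negP; rewrite -ltNge /A /= in_itv.
have fA : mu A \is a fin_num.
  rewrite ge0_fin_numE //; apply: (@le_lt_trans _ _ 1%E); last exact: ltry.
  by rewrite -mu1 le_measure ?inE.
rewrite -(fineK fA); congr EFin; rewrite -v0 /normL2sq /Rintegral; congr fine.
transitivity (\int[mu]_(x in setT) (\1_A x)%:E)%E.
  by rewrite integral_indic // setIT.
apply: eq_integral => x _; congr EFin; rewrite /v /sqn /= indicE.
by case: (x \in A); rewrite ?expr1n ?expr0n addr0.
Qed.

Lemma Linf_inverse u (c : R) : Linf u -> 0 < c -> {ae mu, forall x, c <= sqn (u x)} ->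
  exists2 h, Linf h & {ae mu, forall x, u x * h x = 1}.
Proof.
move=> Lu c0 uc; have [ms _] := bm_sqn Lu.
(* The reciprocal is [conjc u / sqn u]. The maximum with [c] changes it on a null set only, keeps it
   bounded everywhere, and makes [q] monotone, hence measurable. *)
pose q (t : R) := (Num.max c t)^-1.
have m0 t : 0 < Num.max c t by rewrite lt_max c0.
have bq : bm mu (fun x => q (sqn (u x))).
  split.
    apply: (measurableT_comp (f := q)) => //; apply: nonincreasing_measurable => //.
    move=> s t st; rewrite /q lef_pV2 ?posrE //.
    by rewrite ge_max !le_max lexx /= st orbT.
  exists c^-1; apply: aeW => x; rewrite /q ger0_norm ?invr_ge0 ?(ltW (m0 _)) //.
  by rewrite lef_pV2 ?posrE // le_max lexx.
exists (fun x => conjc (u x) * Complex (q (sqn (u x))) 0).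
  by apply: LinfM; [exact: LinfJ|exact: Linf_real].
apply: filterS uc => x cx; rewrite mulrA mulJ /q max_r //.
have n0 : sqn (u x) != 0 by rewrite gt_eqF // (lt_le_trans c0).
by apply: complex_eq; rewrite !reimE /= ?mulfV // ?mul0r ?mulr0 ?subr0 ?addr0.
Qed.

Lemma op_invertible_Hinf u : Hinf P mu u -> op_invertible P (Wrel P (hat u)) ->
  Hinf_invertible P mu u.
Proof.
move=> Hu opu; have [Lu _] := Hu.
have [C C0 HC] := op_invertible_nsq_le hP hmu Hu opu.
have [c c0 uc] := nsq_le_bounded_below Lu C0 HC.
have [h Lh uh] := Linf_inverse Lu c0 uc; exists h => //; split=> //.
have [g [[g2 gP] W _]] := opu.1 _ (is_l2p_hat hP hmu (Hinf_one hP hmu)).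
have ug := (hconv_Wrel hP _ Hu gP).1 W.
have hg := hconv_inverse hP hmu Lu Lh uh g2 ug.
have := hconv_hat hP hmu Lh (Linf_cst mu 1).
have -> : (fun x => h x * 1) = h by apply/funext => x; rewrite mulr1.
by move=> /(hconv_ext hg) <-.
Qed.

Lemma fourier_check_is (k : X -> R[i]) u : Linf u -> check_is mu k u -> hat u = k.
Proof.
move=> Lu uk; apply/funext => xi; apply/eqP; rewrite -subr_eq0; apply/eqP.
apply: sqn_eq0; apply/eqP; rewrite eq_le sqn_ge0 andbT.
apply/ler_addgt0Pl => e e0; rewrite addr0.
have [F0 H] := uk e e0.
(* Once [xi] is among the frequencies, the error [u - trig F k] has [xi]-th coefficient
   [hat u xi - k xi], which Bessel's inequality for the single frequency [xi] bounds. *)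
have := H (xi |` F0)%fset (fsubsetUr _ _); set F := (xi |` F0)%fset => Fe.
have Lt := Linf_trig mu F k; have Ld := LinfB Lu Lt.
have Ne : nsq (fun x => u x - trig F k x) < e.
  rewrite /normL2sq /Rintegral -lte_fin fineK.
    by apply: le_lt_trans Fe; under eq_integral do rewrite -normc2.
  by apply: integrable_fin_num => //; exact: bm_integrable (bm_sqn Ld).
apply: le_trans (ltW Ne); apply: le_trans (Bessel hP hmu [fset xi]%fset Ld).
rewrite big_seq_fset1 (hatB hmu) // (hat_trig hP hmu).
by rewrite !inE eqxx.
Qed.

Lemma op_invertible_ext (T T' : (X -> R[i]) -> (X -> R[i]) -> Prop) :
  (forall g h, is_l2p P g -> T g h <-> T' g h) ->
  op_invertible P T -> op_invertible P T'.
Proof.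
move=> TT' [ex [C HC]]; split.
  move=> h Hh; have [g [g2 Tg uni]] := ex h Hh.
  exists g; split=> //; first exact/TT'.
  by move=> g' g'2 /(TT' _ _ g'2); exact: uni.
by exists C => g h g2 h2 /(TT' _ _ g2); exact: HC.
Qed.

Lemma Hinf_shift u (lam : R[i]) : Hinf P mu u -> Hinf P mu (fun x => u x - lam).
Proof.
move=> [Lu u0]; split; first by apply: LinfB => //; exact: Linf_cst.
have L1 := Linf_cst mu (1 : R[i]).
move=> xi nPx; rewrite (_ : (fun x => _) = (fun x => u x - lam * 1)).
  rewrite (hatB hmu) ?(hatZ hmu) ?u0 //; last exact: LinfZ.
  by rewrite (proj2 (Hinf_one hP hmu) _ nPx) mulr0 subr0.
by apply/funext => x; rewrite mulr1.
Qed.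

Lemma hat_shift u (lam : R[i]) xi : Linf u ->
  hat (fun x => u x - lam) xi = hat u xi - lam * (xi == 0)%:R.
Proof.
move=> Lu; have L1 := Linf_cst mu (1 : R[i]).
rewrite (_ : (fun x => _) = (fun x => u x - lam * 1)).
  rewrite (hatB hmu) ?(hatZ hmu) ?(hat_one hP hmu) //; exact: LinfZ.
by apply/funext => x; rewrite mulr1.
Qed.

(** Subtracting the constant [lam] from [u] changes its coefficients only at [0], and convolution
    with the unit mass at [0] is the identity. *)
Lemma Wshift_Wrel u (lam : R[i]) g h : Linf u -> (forall xi, ~ P xi -> g xi = 0) ->
  Wshift P (hat u) lam g h <-> Wrel P (hat (fun x => u x - lam)) g h.
Proof.
move=> Lu g0.
have dl xi : has_sum (fun eta => lam * (xi - eta == 0)%:R * g eta) (lam * g xi).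
  have := @has_sum_fin R X (fun eta => lam * (xi - eta == 0)%:R * g eta) [fset xi]%fset.
  rewrite big_seq_fset1 subrr eqxx mulr1; apply => eta.
  by rewrite inE subr_eq0 eq_sym => /negbTE ->; rewrite mulr0 mul0r.
split=> W xi; split=> [Px|nPx].
- have := has_sumB ((W xi).1 Px) (dl xi); rewrite addrK.
  by apply: has_sum_eq => eta; rewrite hat_shift // mulrBl.
- by have := (W xi).2 nPx; rewrite g0 // mulr0 addr0.
- have := has_sumD ((W xi).1 Px) (dl xi).
  by apply: has_sum_eq => eta; rewrite hat_shift // -mulrDl subrK.
- by rewrite (W xi).2 // g0 // mulr0 addr0.
Qed.

End WienerConverse.

Theorem mainTheorem8 (R : realType) (X : zmodType) (P : set X)
  (hP : pos_cone P)
  (mu : {measure set (Gmeas R X) -> \bar R}) (hmu : haar mu)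
  (k : X -> R[i]) (hk : is_l2 k)
  (f : Gmeas R X -> R[i]) (hf : check_is mu k f) (hfH : Hinf P mu f) :
  (op_invertible P (Wrel P k) <-> Hinf_invertible P mu f) /\
  [set lam : R[i] | ~ op_invertible P (Wshift P k lam)] =
  [set lam : R[i] | ~ Hinf_invertible P mu (fun x => f x - lam)].
Proof.
have [Lf _] := hfH.
rewrite -(fourier_check_is hP hmu Lf hf).
(* Stated for every element of [H^oo], so that it applies both to [f] and to each [f - lam]. *)
have key u : Hinf P mu u ->
    op_invertible P (Wrel P (fourier mu u)) <-> Hinf_invertible P mu u.
  by move=> Hu; split; [exact: op_invertible_Hinf|exact: Hinf_invertible_op].
split; first exact: key.
apply/seteqP; split=> lam /= nlam inv; apply: nlam.
  have := (key _ (Hinf_shift hP hmu lam hfH)).2 inv.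
  by apply: op_invertible_ext => g h [_ g0]; apply: iff_sym; exact: Wshift_Wrel.
apply/(key _ (Hinf_shift hP hmu lam hfH)); move: inv.
by apply: op_invertible_ext => g h [_ g0]; exact: Wshift_Wrel.
Qed.
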